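(* Let $\mathbf{ER}$ be the pseudovariety of finite semigroups $T$ whose idempotent-generated subsemigroup $\langle E(T)\rangle$ is $\mathcal{R}$-trivial. Then $\mathbf{ER}$ has decidable pointlikes, i.e. there is an algorithm which, given any finite semigroup $S$ as input, produces the set $\mathsf{PL}_{\mathbf{ER}}(S)$ of all $\mathbf{ER}$-pointlike subsets of $S$. In particular, for every finite semigroup $S$ one has $\mathsf{PL}_{\mathbf{ER}}(S) = \mathsf{C}_{\mathbf{ER}}(S)$.
   Context: For a finite semigroup $T$: $T^I$ is $T$ with a new identity element $I$ adjoined; $E(T)$ is the set of idempotents of $T$. A relational morphism $\rho : S \to T$ between finite semigroups is (equivalently) a subsemigroup $\rho \subseteq S\times T$ whose projection to $S$ is surjective; for $v\in T$, $(v)\rho^{-1}=\{s\in S : (s,v)\in\rho\}$. For a pseudovariety $\mathbf V$, a non-empty subset $X\subseteq S$ is $\mathbf V$-pointlike if for every relational morphism $\rho:S\to V$ with $V\in\mathbf V$ there is $v\in V$ with $X\subseteq (v)\rho^{-1}$; $\mathsf{PL}_{\mathbf V}(S)$ is the set of all $\mathbf V$-pointlike subsets of $S$. Group kernel: $K_{\mathbf G}(T)$ is the subsemigroup of all $x\in T$ such that $x\in(1_G)\rho^{-1}$ for every relational morphism $\rho:T\to G$ with $G$ a finite group. Type-II partition: for $x,y\in T$, $x\equiv_{\mathrm{II}} y$ iff there are $a,b\in K_{\mathbf G}(T)^I$ with $xa=y$ and $yb=x$; $[x]_{\mathrm{II}}$ denotes the class of $x$. $\mathcal P(S)$ is the semigroup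 of non-empty subsets of $S$ under $X\cdot Y=\{xy : x\in X,y\in Y\}$. An $S$-complex is a subsemigroup $\mathcal K\subseteq\mathcal P(S)$ containing all singletons and closed under taking non-empty subsets of its members. $\mathsf C_{\mathbf{ER}}(S)$ is the intersection of all $S$-complexes $\mathcal K$ such that for every idempotent $E$ of the semigroup $\mathcal K$, the union $\bigcup [E]_{\mathrm{II}}$ belongs to $\mathcal K$, where $[E]_{\mathrm{II}}\subseteq\mathcal K$ is the type-II class of $E$ computed in the semigroup $\mathcal K$ (it is itself the smallest such $S$-complex). *)

(* Defs.v *)
From HB Require Import structures.
From mathcomp Require Import all_boot.

Set Implicit Arguments.
Unset Strict Implicit.
Unset Printing Implicit Defensive.

(* HB only accepts this structure when it is declared before [fingroup], whose
   FinStarMonoid structure it would otherwise have to be a parent of. *)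
#[short(type="finSemigroupType")]
HB.structure Definition FinSemigroup := {T of Semigroup T & Finite T}.

From mathcomp Require Import fingroup boolp.

Local Open Scope group_scope.

(* Notions concerning a finite semigroup are stated for a subsemigroup A of an
   ambient finite semigroup T, with A := [set: T] for T itself.  This makes them
   available for semigroups of subsets such as the complexes below. *)
Section Semigroups.
Variable T : finSemigroupType.
Implicit Types (x y : T) (A B : {set T}).

Definition subsemigroup A := [forall x in A, forall y in A, x * y \in A].

Definition gen_subsemigroup A : {set T} :=
  \bigcap_(B : {set T} | (A \subset B) && subsemigroup B) B.

Definition idem x := x * x == x.

Definition idempotents A : {set T} := [set x in A | idem x].

(* x A^I, where A^I is A with a new identity adjoined *)
Definition right_mult1 A x : {set T} := x |: [set x * a | a in A].

(* Green's R relation of A is equality of principal right ideals x A^I *)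
Definition R_trivial A : Prop := {in A &, injective (right_mult1 A)}.

Definition relational_morphism A (V : semigroupType) (rho : {pred T * V}) :
    Prop :=
  [/\ {in rho, forall p, p.1 \in A}, mulg_closed rho
    & forall x, x \in A -> exists v, (x, v) \in rho].

Definition group_kernel A : {set T} :=
  [set x in A | `[< forall (G : finGroupType) (rho : {pred T * G}),
                      relational_morphism A rho -> (x, 1) \in rho >]].

Definition typeII A x y :=
  (y \in right_mult1 (group_kernel A) x)
    && (x \in right_mult1 (group_kernel A) y).

Definition typeII_class A x : {set T} := [set y in A | typeII A x y].

End Semigroups.

Definition ER (T : finSemigroupType) : Prop :=
  R_trivial (gen_subsemigroup (idempotents [set: T])).

Section PowerSemigroup.
Variable S : finSemigroupType.

Record powersemi := PowerSemi { pset :> {set S}; pset_neq0 : pset != set0 }.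

HB.instance Definition _ := [isSub for pset].
HB.instance Definition _ := [Finite of powersemi by <:].

Implicit Types X Y : powersemi.

Lemma powersemi_mul_neq0 X Y :
  [set x * y | x in X : {set S}, y in Y : {set S}] != set0.
Proof.
case: X Y => [X /set0Pn[x Xx]] [Y /set0Pn[y Yy]] /=.
by apply/set0Pn; exists (x * y); apply: imset2_f.
Qed.

Definition powersemi_mul X Y : powersemi :=
  PowerSemi (powersemi_mul_neq0 X Y).

Lemma powersemi_mulA : associative powersemi_mul.
Proof.
move=> X Y Z; apply/val_inj/setP => t /=; apply/imset2P/imset2P => /=.
  case=> x _ Xx /imset2P[y z Yy Zz ->] ->.
  by exists (x * y) z; rewrite ?mulgA //; apply: imset2_f.
case=> _ z /imset2P[x y Xx Yy ->] Zz ->.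
by exists x (y * z); rewrite ?mulgA //; apply: imset2_f.
Qed.

HB.instance Definition _ := isSemigroup.Build powersemi powersemi_mulA.

Lemma powersemi1_neq0 (s : S) : [set s] != set0.
Proof. by apply/set0Pn; exists s; rewrite set11. Qed.

Definition powersemi1 (s : S) : powersemi := PowerSemi (powersemi1_neq0 s).

Implicit Types K : {set powersemi}.

Definition complex K :=
  [&& subsemigroup K,
      [forall s, powersemi1 s \in K]
    & [forall X in K, forall Y : powersemi,
         (Y \subset X) ==> (Y \in K)]].

Definition ER_complex K :=
  complex K &&
  [forall E in idempotents K,
     [exists U in K, pset U == \bigcup_(X in typeII_class K E) X]].

Definition C_ER : {set powersemi} :=
  \bigcap_(K : {set powersemi} | ER_complex K) K.

Definition pointlike (V : finSemigroupType -> Prop) X : Prop :=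
  forall (T : finSemigroupType) (rho : {pred S * T}),
    V T -> relational_morphism [set: S] rho ->
    exists v, forall x, x \in X -> (x, v) \in rho.

Definition PL (V : finSemigroupType -> Prop) : {set powersemi} :=
  [set X | `[< pointlike V X >]].

End PowerSemigroup.

(* Algorithms are partial recursive functions; [recfun n] is the type of
   Kleene's schemes of arity n. *)
Inductive recfun : nat -> Type :=
| RZero n : recfun n
| RSucc : recfun 1
| RProj n : 'I_n -> recfun n
| RComp m n : recfun m -> ('I_m -> recfun n) -> recfun n
| RPrec n : recfun n -> recfun n.+2 -> recfun n.+1
| RMu n : recfun n.+1 -> recfun n.

Fixpoint primrec_graph (base : nat -> Prop) (step : nat -> nat -> nat -> Prop)
    (k y : nat) : Prop :=
  if k is k'.+1 then exists2 z, primrec_graph base step k' z & step k' z y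
  else base y.

(* [computes f v y]: on input v, f halts with output y. *)
Fixpoint computes n (f : recfun n) : n.-tuple nat -> nat -> Prop :=
  match f in recfun n return n.-tuple nat -> nat -> Prop with
  | RZero _ => fun _ y => y = 0
  | RSucc => fun v y => y = (thead v).+1
  | RProj _ i => fun v y => y = tnth v i
  | RComp m _ g h => fun v y =>
      exists2 w : m.-tuple nat,
        (forall i, computes (h i) v (tnth w i)) & computes g w y
  | RPrec _ g h => fun v =>
      primrec_graph (computes g [tuple of behead v])
        (fun k z => computes h [tuple of k :: z :: behead v]) (thead v)
  | RMu _ g => fun v y =>
      computes g [tuple of y :: v] 0 /\
      (forall z, z < y -> exists u, computes g [tuple of z :: v] u.+1)
  end.

Lemma computes_fun n (f : recfun n) v y y' :
  computes f v y -> computes f v y' -> y = y'.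
Proof.
elim: f v y y' => {n} /=.
- by move=> n v y y' -> ->.
- by move=> v y y' -> ->.
- by move=> n i v y y' -> ->.
- move=> m n g IHg h IHh v y y' [w hw gw] [w' hw' gw'].
  have eqw : w = w' by apply/eq_from_tnth => i; apply: IHh (hw i) (hw' i).
  by rewrite -eqw in gw'; apply: IHg gw gw'.
- move=> n g IHg h IHh v; elim: (thead v) => [|k IHk] y y' /=; first exact: IHg.
  by case=> z kz hz [z' kz' hz']; rewrite -(IHk _ _ kz kz') in hz'; apply: IHh hz hz'.
- move=> n g IHg v y y' [gy miny] [gy' miny'].
  case: (ltngtP y y') => // [/miny'|/miny] [u gu].
    by have := IHg _ _ _ gy gu.
  by have := IHg _ _ _ gy' gu.
Qed.

Section Encoding.
Variables (S : finSemigroupType) (s : seq S).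

(* Relative to an enumeration s of S, elements are represented by their
   position in s. *)
Definition mult_table : seq (seq nat) :=
  [seq [seq index (x * y) s | y <- s] | x <- s].

Definition positions (X : {set S}) : seq nat :=
  [seq index x s | x <- s & x \in X].

End Encoding.

Definition encode (l : seq (seq nat)) : nat :=
  CodeSeq.code [seq CodeSeq.code r | r <- l].

(* The input is a multiplication table of S, with respect to an arbitrary
   enumeration of S; the output is a list of all the pointlike subsets of S. *)
Definition decidable_pointlikes (V : finSemigroupType -> Prop) : Prop :=
  exists f : recfun 1,
    forall (S : finSemigroupType) (s : seq S),
      uniq s -> (forall x, x \in s) ->
      exists2 l : seq (seq nat),
        computes f [tuple encode (mult_table s)] (encode l)
        & l =i [seq positions s (pset X) | X in PL S V].

(* Main.v *)
Require Import Defs.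
From HB Require Import structures.
From mathcomp Require Import all_boot fingroup perm boolp zify.
(* Right multiplication by [s], restricted to the elements of an R-class that it
   keeps in that R-class, is injective modulo the type-II relation, and type-II
   is the smallest equivalence with this property: modulo such an equivalence
   the partial injections extend to permutations, which is a relational morphism
   to a group whose kernel acts trivially.

   [C_ER <= PL]: when T is in ER, equality itself has this property.  Given a
   relational morphism to T and an idempotent E of PL related to t, with t
   R-minimal, the elements of T related to members of the kernel of PL that
   appear in the type-II class of E fix t, so the whole class is related to t.

   [PL <= K] for an ER-complex K: every X in K lies in a saturated Z in K, one
   containing the union of its type-II class, such that Z is type-II equivalent
   to X or strictly R-below X.  Letting s act by [Z |-> saturation of Z s] gives
   maps on the saturated sets that go down in the R-order and are injective where
   they stay on the same level.  The idempotents among such maps move a point only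
   to a strictly lower level, so the maps form a semigroup in ER.

   Decidability follows since the minimality of type-II gives a finite test for
   it, which turns the definition of [C_ER] into a finite computation. *)

Set Implicit Arguments.
Unset Strict Implicit.
Unset Printing Implicit Defensive.

Local Open Scope group_scope.

(** * Powers and local inverses in finite semigroups *)

Section Powers.
Variable T : semigroupType.
Implicit Types x : T.

(* The power [x ^ n.+1]: there is no [x ^ 0] in a semigroup. *)
Definition spow x n : T := iter n ( *%g x) x.

Lemma spowS x n : spow x n.+1 = x * spow x n. Proof. by []. Qed.

Lemma spowD x m n : spow x m * spow x n = spow x (m + n).+1.
Proof. by elim: m => //= m IH; rewrite -mulgA IH. Qed.

Lemma spow_closed (P : {pred T}) x n : mulg_closed P -> x \in P -> spow x n \in P.
Proof. by move=> cP Px; elim: n => //= n IH; apply: cP. Qed.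

Lemma idem_spow x n : x * x = x -> spow x n = x.
Proof. by move=> xx; elim: n => //= n ->. Qed.

End Powers.

Section Subsemigroups.
Variable T : finSemigroupType.
Implicit Types (x : T) (A : {set T}).

Lemma subsemigroupP A : reflect (mulg_closed A) (subsemigroup A).
Proof.
by apply: (iffP 'forall_in_forall_inP) => cA x y Ax; [apply: cA | move=> Ay; apply: cA].
Qed.

Lemma subsemigroupT : subsemigroup [set: T].
Proof. by apply/subsemigroupP => x y _ _; rewrite inE. Qed.

(** By pigeonhole two powers coincide. The same [n] serves as threshold and, increased by one, as
    period, so that [spow x n], whose square is [spow x (n + n.+1)], is idempotent. *)
Lemma spow_period x :
  exists n, forall m, n <= m -> spow x (m + n.+1) = spow x m.
Proof.
have [i [p pS]] : exists i p, spow x (i + p.+1) = spow x i.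
  have /injectivePn [a [b ab eab]] : ~~ injectiveb (fun i : 'I_#|T|.+1 => spow x i).
    by apply/negP => /injectiveP/leq_card; rewrite card_ord ltnn.
  wlog lt_ab : a b ab eab / a < b.
    move=> W; have := ab; rewrite -val_eqE neq_ltn => /orP[] lt; first exact: W lt.
    by apply: W lt; rewrite // eq_sym.
  by exists a, (b - a.+1); rewrite eab; congr spow; lia.
have shift d : spow x (i + d + p.+1) = spow x (i + d).
  elim: d => [|d IH]; first by rewrite addn0.
  by rewrite (addnS i) addSn !spowS IH.
have per k m : i <= m -> spow x (m + k * p.+1) = spow x m.
  move=> im; elim: k => [|k IH]; first by rewrite addn0.
  rewrite -IH; have -> : (m + k * p.+1 = i + (m - i + k * p.+1))%N by lia.
  by rewrite -shift; congr spow; lia.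
(* For this [n], the number [n.+1 = i.+1 * p.+1] is a multiple of the period [p.+1], and [n] is at
   least [i]. *)
exists (i * p.+1 + p)%N => m im; rewrite -(per i.+1 m) ?mulSn; last by nia.
by congr spow; lia.
Qed.

Lemma idem_power x : exists n, idem (spow x n).
Proof.
have [n per] := spow_period x; exists n.
by rewrite /idem spowD -addnS per.
Qed.

(* [w] is a local inverse of [s] at [x]: whenever [s] is related to [h] in a
   group then [w] is related to [h^-1]. *)
Lemma weak_inverse A x s u : subsemigroup A -> s \in A -> u \in A ->
  x * s * u = x -> exists w, [/\ w \in A, w * s * w = w & x * s * w = x].
Proof.
move=> /subsemigroupP cA As Au xsu; have [n per] := spow_period (s * u).
have xp k : x * spow (s * u) k = x.
  by elim: k => [|k IH]; rewrite ?spowS !mulgA xsu.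
have swE : s * (u * spow (s * u) n.*2) = spow (s * u) n.*2.+1 by rewrite mulgA.
(* Since [spow] counts exponents from one, [s * w] is the power of [s * u] with exponent twice the
   period [n.+1]; multiplying [w] by it changes nothing, and it still fixes [x]. *)
exists (u * spow (s * u) n.*2); split.
- by apply: (cA) => //; apply: spow_closed (cA) (cA _ _ As Au).
- rewrite -!mulgA swE; congr (u * _); rewrite spowD -[RHS](per); last by lia.
  by rewrite -[RHS]per; [congr spow; lia | lia].
- by rewrite -mulgA swE xp.
Qed.

End Subsemigroups.

(** * The group kernel and the type-II relation *)

Section GroupKernel.
Variables (T : finSemigroupType) (A : {set T}).
Hypothesis cA : subsemigroup A.
Implicit Types (x y s u w : T).

Local Notation K := (group_kernel A).

Lemma relational_mul (V : semigroupType) (rho : {pred T * V}) x y (v w : V) :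
  relational_morphism A rho -> (x, v) \in rho -> (y, w) \in rho ->
  (x * y, v * w) \in rho.
Proof. by case=> _ crho _; apply: crho. Qed.

Lemma relational_spow (V : semigroupType) (rho : {pred T * V}) x v n :
  relational_morphism A rho -> (x, v) \in rho -> (spow x n, spow v n) \in rho.
Proof. by move=> rhoP xv; elim: n => //= n; apply: relational_mul. Qed.

Lemma group_kernelP x : reflect
  (x \in A /\ forall (G : finGroupType) (rho : {pred T * G}),
     relational_morphism A rho -> (x, 1) \in rho)
  (x \in K).
Proof. by rewrite inE; apply: (iffP andP) => -[Ax /asboolP]. Qed.

Lemma spow_expg (G : finGroupType) (g : G) n : spow g n = g ^+ n.+1.
Proof. by elim: n => [|n IH]; rewrite ?expg1 // spowS IH -expgS. Qed.

(** An idempotent related to [g] equals its own power with exponent the order of [g], hence is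
    related to [1]. *)
Lemma idem_kernel e : e \in A -> idem e -> e \in K.
Proof.
move=> Ae /eqP ee; apply/group_kernelP; split=> // G rho rhoP.
have [_ _ /(_ e Ae) [g eg]] := rhoP.
have := relational_spow #[g].-1 rhoP eg.
by rewrite idem_spow // spow_expg prednK // expg_order.
Qed.

Lemma kernel_closed : subsemigroup K.
Proof.
apply/subsemigroupP => x y /group_kernelP[Ax xK] /group_kernelP[Ay yK].
apply/group_kernelP; split=> [|G rho rhoP]; first by move/subsemigroupP: cA; apply.
by have := relational_mul rhoP (xK _ _ rhoP) (yK _ _ rhoP); rewrite mulg1.
Qed.

(** If [w] is related to [g], the idempotent [w * s] is related to all positive powers of [g * h],
    among them the inverse. Hence [w = w * s * w] is related to [(g * h)^-1 * g = h^-1]. *)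
Lemma weak_inverse_label (G : finGroupType) (rho : {pred T * G}) s w h :
  relational_morphism A rho -> w \in A -> w * s * w = w -> (s, h) \in rho ->
  (w, h^-1) \in rho.
Proof.
move=> rhoP Aw wsw sh; have [_ _ /(_ w Aw) [g wg]] := rhoP.
have := relational_spow #[g * h].*2.-2 rhoP (relational_mul rhoP wg sh).
rewrite idem_spow ?mulgA ?wsw // spow_expg.
(* The exponent is -1 modulo the order of [g * h]; one order is added so that it stays positive when
   that order is 1. *)
have -> : #[g * h].*2.-2.+1 = (#[g * h].-1 + #[g * h])%N.
  by have := order_gt0 (g * h); lia.
rewrite expgnDr expg_order mulg1 -invg_expg => /relational_mul /(_ wg).
by rewrite wsw invMg mulgKV => /(_ rhoP).
Qed.

(** When [s] is related to [h], [w] is related to [h^-1], so both products are related to conjugates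
    of [1]. *)
Lemma conj_kernel w s k : w \in A -> s \in A -> w * s * w = w -> k \in K ->
  w * k * s \in K /\ s * k * w \in K.
Proof.
move/subsemigroupP: (cA) => mA Aw As wsw /group_kernelP[Ak kK].
split; apply/group_kernelP; split; try by do 2?apply: (mA).
  move=> G rho rhoP; have [_ _ /(_ s As) [h sh]] := rhoP.
  have wh := weak_inverse_label rhoP Aw wsw sh.
  have := relational_mul rhoP (relational_mul rhoP wh (kK _ _ rhoP)) sh.
  by rewrite mulg1 mulVg.
move=> G rho rhoP; have [_ _ /(_ s As) [h sh]] := rhoP.
have wh := weak_inverse_label rhoP Aw wsw sh.
have := relational_mul rhoP (relational_mul rhoP sh (kK _ _ rhoP)) wh.
by rewrite mulg1 mulgV.
Qed.

Lemma weak_inverse_kernel k w : k \in K -> w \in A -> w * k * w = w -> w \in K.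
Proof.
move=> /group_kernelP[_ kK] Aw wkw; apply/group_kernelP; split=> // G rho rhoP.
by rewrite -[1]invg1; apply: weak_inverse_label wkw (kK _ _ rhoP).
Qed.

End GroupKernel.

Lemma right_mult1P (T : finSemigroupType) (B : {set T}) x y :
  reflect (y = x \/ exists2 b, b \in B & y = x * b) (y \in right_mult1 B x).
Proof.
rewrite !inE; apply: (iffP orP) => [[/eqP|/imsetP]|[->|yx]]; [by left|by right|by left|].
by right; apply/imsetP.
Qed.

Lemma right_mult1_refl (T : finSemigroupType) (B : {set T}) x : x \in right_mult1 B x.
Proof. by apply/right_mult1P; left. Qed.

Lemma right_mult1_trans (T : finSemigroupType) (B : {set T}) x y z :
  subsemigroup B -> y \in right_mult1 B x -> z \in right_mult1 B y ->
  z \in right_mult1 B x.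
Proof.
move=> /subsemigroupP mB /right_mult1P[->//|[b Bb ->]] /right_mult1P[->|[c Bc ->]].
  by apply/right_mult1P; right; exists b.
by apply/right_mult1P; right; exists (b * c); rewrite ?mulgA //; apply: mB.
Qed.

(** The pairs are added one at a time: the permutation [g] found so far is followed by the
    transposition of [g a] and [b]. Injectivity keeps the images of the earlier pairs away from both
    points. *)
Lemma extend_to_perm (D : finType) (l : seq (D * D)) :
  {in l &, forall p q, (p.1 == q.1) = (p.2 == q.2)} ->
  exists g : {perm D}, forall p, p \in l -> g p.1 = p.2.
Proof.
elim: l => [|[a b] l IH] inj_l; first by exists 1.
have lS p : p \in l -> p \in (a, b) :: l by rewrite inE orbC => ->.
have [|g gP] := IH; first by move=> p q /lS lp /lS; apply: inj_l.
have [/mapP [[a' b'] lp /= ea]|la] := boolP (a \in map fst l).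
  have /esym := inj_l _ _ (mem_head _ _) (lS _ lp).
  rewrite /= ea eqxx => /eqP eb.
  exists g => p; rewrite inE => /predU1P[->|]; last exact: gP.
  by rewrite eb; apply: gP lp.
exists (g * tperm (g a) b) => p; rewrite inE permM => /predU1P[->/=|lp].
  by rewrite tpermL.
have na : a != p.1 by apply: contra la => /eqP->; apply: map_f.
rewrite (gP p lp) tpermD //; first by rewrite -(gP p lp) (inj_eq perm_inj).
by have := inj_l _ _ (mem_head _ _) (lS _ lp) => /= <-.
Qed.

(* For [x s u = x], right multiplication by [s] keeps [x] in its R-class; hence
   [s] acts on an R-class, modulo a stable equivalence, as a partial injection. *)
Definition stable (T : finSemigroupType) (A : {set T}) (r : rel T) :=
  forall x y s u v, x \in A -> y \in A -> s \in A -> u \in A -> v \in A ->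
    x * s * u = x -> y * s * v = y -> r x y = r (x * s) (y * s).

Section TypeII.
Variables (T : finSemigroupType) (A : {set T}).
Hypothesis cA : subsemigroup A.
Implicit Types (x y s u w : T) (r : rel T).

Local Notation K := (group_kernel A).
Let mA : mulg_closed A. Proof. exact/subsemigroupP. Qed.

Lemma kernel_sub : {subset K <= A}.
Proof. by move=> k /group_kernelP[]. Qed.

Lemma stable_label r : {in A & &, equivalence_rel r} -> stable A r ->
  exists (G : finGroupType) (rho : {pred T * G}), relational_morphism A rho /\
    forall s, (s, 1) \in rho -> forall x u, x \in A -> u \in A ->
      x * s * u = x -> r x (x * s).
Proof.
move=> eq_r st_r; pose cls x : {set T} := [set y in A | r x y].
have clsE x y : x \in A -> y \in A -> (cls x == cls y) = r x y.
  move=> Ax Ay; apply/eqP/idP => [/setP/(_ y)|rxy].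
    by rewrite !inE Ay (eq_r y y y Ay Ay Ay).1.
  by apply/setP=> z; rewrite !inE; case Az: (z \in A);
    rewrite //= ((eq_r x y z Ax Ay Az).2 rxy).
(* An element is related to every permutation that extends its partial action on the classes. *)
pose rho : {pred T * {perm {set T}}} := [pred p : T * {perm {set T}} |
  (p.1 \in A) && [forall x in A,
  forall u in A, (x * p.1 * u == x) ==> (p.2 (cls x) == cls (x * p.1))]].
have rhoP (p : T * {perm {set T}}) : reflect (p.1 \in A /\ forall x u, x \in A -> u \in A ->
    x * p.1 * u = x -> p.2 (cls x) = cls (x * p.1)) (p \in rho).
  rewrite inE; apply: (iffP andP) => -[Ap pP]; split=> //.
    move=> x u Ax Au xpu; apply/eqP; move/forall_inP: pP => /(_ x Ax)/forall_inP.
    by move=> /(_ u Au)/implyP; apply; apply/eqP.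
  apply/forall_inP => x Ax; apply/forall_inP => u Au; apply/implyP => /eqP xpu.
  by apply/eqP; apply: pP xpu.
exists {perm {set T}}, rho; split; last first.
  move=> s /rhoP[/= As sP] x u Ax Au xsu; rewrite -clsE //; last exact: mA.
  by rewrite -(sP x u) // perm1.
split=> [p /rhoP[]//|[s g] [t h] /rhoP[/= As sg] /rhoP[/= At th]|s As].
  apply/rhoP; split=> [|x u Ax Au]; first exact: mA.
  rewrite permM /= !mulgA => xstu.
  (* If [s * t] keeps [x] in its R-class, then so does [s], with return [t * u], and [t] keeps
     [x * s] in its R-class, with return [u * s]. *)
  rewrite (sg x (t * u)) ?mulgA //; last exact: mA.
  by rewrite (th (x * s) (u * s)) ?mulgA ?xstu //; apply: mA.
(* [D] is the domain of the partial action of [s]; stability makes this action well defined and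
   injective on classes. *)
pose D := [set x in A | [exists u in A, x * s * u == x]].
have [|g gP] := @extend_to_perm _ [seq (cls x, cls (x * s)) | x <- enum D].
  move=> _ _ /mapP[x Dx ->] /mapP[y Dy ->] /=; move: Dx Dy.
  rewrite !mem_enum !inE => /andP[Ax /exists_inP[u Au /eqP xsu]].
  move=> /andP[Ay /exists_inP[v Av /eqP ysv]].
  by rewrite !clsE //; [apply: st_r xsu ysv | apply: mA | apply: mA].
exists g; apply/rhoP; split=> // x u Ax Au xsu.
apply: (gP (cls x, cls (x * s))); apply/mapP; exists x => //.
by rewrite mem_enum inE Ax; apply/exists_inP; exists u => //; apply/eqP.
Qed.

Lemma typeII_equivalence : equivalence_rel (typeII A).
Proof.
have cK := kernel_closed cA.
have sym x y : typeII A x y = typeII A y x by rewrite /typeII andbC.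
have trans x y z : typeII A x y -> typeII A y z -> typeII A x z.
  rewrite /typeII => /andP[xy yx] /andP[yz zy].
  by rewrite (right_mult1_trans cK xy yz) (right_mult1_trans cK zy yx).
move=> x y z; split=> [|xy]; first by rewrite /typeII !right_mult1_refl.
by apply/idP/idP; apply: trans; rewrite // sym.
Qed.

(** With [w] a local inverse of [s] at [x], [y = x * k] gives [y * s = x * s * (w * k * s)]; with
    one at [y], [y * s = x * s * k] gives [y = x * (s * k * w)]. The kernel is closed under both
    conjugations. *)
Lemma stable_typeII : stable A (typeII A).
Proof.
suff half x y s u v : x \in A -> y \in A -> s \in A -> u \in A -> v \in A ->
    x * s * u = x -> y * s * v = y ->
    (y \in right_mult1 K x) = (y * s \in right_mult1 K (x * s)).
  move=> x y s u v Ax Ay As Au Av xsu ysv; rewrite /typeII.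
  by rewrite (half x y s u v) // (half y x s v u).
move=> Ax Ay As Au Av xsu ysv.
apply/right_mult1P/right_mult1P => [[->|[k Kk ->]]|]; first by left.
  have [w [Aw wsw xsw]] := weak_inverse cA As Au xsu.
  right; exists (w * k * s); first by case: (conj_kernel cA Aw As wsw Kk).
  by rewrite !mulgA xsw.
have [w [Aw wsw ysw]] := weak_inverse cA As Av ysv; case=> [eys|[k Kk eys]]; right.
  (* If [y * s = x * s], the kernel element leading from [x] to [y] is the idempotent [s * w]. *)
  exists (s * w); last by rewrite mulgA -eys.
  by apply: idem_kernel; [apply: mA | rewrite /idem -mulgA (mulgA w) wsw].
exists (s * k * w); first by case: (conj_kernel cA Aw As wsw Kk).
by rewrite !mulgA -eys.
Qed.

Lemma typeII_kernel x y : typeII A x y ->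
  y = x \/ exists a b, [/\ a \in K, b \in K, y = x * a & x = y * b].
Proof.
move=> /andP[/right_mult1P[->|[a Ka ya]]]; first by left.
by move=> /right_mult1P[->|[b Kb xb]]; [left | right; exists a, b].
Qed.

(* The group kernel enters the type-II relation only through this description,
   so no algorithm for computing the kernel itself is needed. *)
Lemma typeII_stableP x y : x \in A -> y \in A ->
  typeII A x y <->
  forall r, {in A & &, equivalence_rel r} -> stable A r -> r x y.
Proof.
move=> Ax Ay; split=> [/typeII_kernel xy r eq_r st_r|]; last first.
  by apply; [move=> ? ? ? _ _ _; apply: typeII_equivalence | apply: stable_typeII].
case: xy => [->|[a [b [/group_kernelP[Aa Ka] Kb ya xb]]]].
  by case: (eq_r x x x Ax Ax Ax).
have [G [rho [rhoP rho1]]] := stable_label eq_r st_r.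
by rewrite ya (rho1 a (Ka _ _ rhoP) x b) ?(kernel_sub Kb) // -ya -xb.
Qed.

End TypeII.

Lemma right_mult1S (T : finSemigroupType) (B : {set T}) x y :
  subsemigroup B -> (right_mult1 B y \subset right_mult1 B x) = (y \in right_mult1 B x).
Proof.
move=> cB; apply/subsetP/idP => [|yx z]; first by apply; apply: right_mult1_refl.
exact: right_mult1_trans.
Qed.

(** An element whose principal right ideal has the fewest elements will do: a subset of that ideal
    of at least the same size is all of it. *)
Lemma R_minimal (T : finSemigroupType) (B : {set T}) (P : pred T) x0 :
  subsemigroup B -> P x0 -> exists2 x, P x &
    forall y, P y -> y \in right_mult1 B x -> x \in right_mult1 B y.
Proof.
move=> cB Px0; case: (@arg_minnP _ x0 P (fun x => #|right_mult1 B x|)) => // x Px minx.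
exists x => // y Py; rewrite -!right_mult1S // => yx.
by rewrite -(geq_leqif (subset_leqif_card yx)) minx.
Qed.

(** A power of an R-minimal element is R-below it, hence R-minimal too; an idempotent power is
    taken. *)
Lemma R_minimal_idem (T : finSemigroupType) (B : {set T}) x0 :
  subsemigroup B -> x0 \in B -> exists2 e, e \in B &
    idem e /\ forall x, x \in B -> e \in right_mult1 B (e * x).
Proof.
move=> cB Bx0; have mB := subsemigroupP _ cB.
have [y By miny] := R_minimal cB Bx0; have [n ee] := idem_power y.
have Be : spow y n \in B by apply: spow_closed.
exists (spow y n) => //; split=> // x Bx; move: Be; set e := spow y n => Be.
have ye : e \in right_mult1 B y.
  case: n @e {ee Be} => [|n]; first exact: right_mult1_refl.
  by apply/right_mult1P; right; exists (spow y n); rewrite // spow_closed.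
have eex : e * x \in right_mult1 B e by apply/right_mult1P; right; exists x.
have yex : y \in right_mult1 B (e * x).
  by apply: miny; [apply: mB | apply: right_mult1_trans eex].
exact: right_mult1_trans ye.
Qed.

(** * Semigroups in ER *)

Section ERSemigroups.
Variable T : finSemigroupType.

Lemma gen_subsemigroup_closed (A : {set T}) : subsemigroup (gen_subsemigroup A).
Proof.
apply/subsemigroupP => x y /bigcapP Ax /bigcapP Ay; apply/bigcapP => B AB.
by move/andP: (AB) => [_ /subsemigroupP]; apply; [apply: Ax | apply: Ay].
Qed.

Lemma gen_subsemigroup_min (A B : {set T}) :
  A \subset B -> subsemigroup B -> gen_subsemigroup A \subset B.
Proof. by move=> AB cB; apply: bigcap_inf; rewrite AB. Qed.

Lemma sub_gen_subsemigroup (A : {set T}) : A \subset gen_subsemigroup A.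
Proof. by apply/bigcapsP => B /andP[]. Qed.

(** Local inverses of [s] at [x] and [y] give idempotents [f] and [g] with [y * f = x] and
    [x * g = y]. The idempotent power [p] of [g * f] fixes [x] and is R-equivalent to [p * g] within
    the idempotent-generated subsemigroup [H]. Hence [p = p * g], and
    [x = x * p = x * p * g = y]. *)
Lemma ER_stable_eq : ER T -> stable [set: T] eq_op.
Proof.
move=> ER_T x y s u v _ _ _ _ _ xsu ysv.
apply/eqP/eqP => [->//|eqs]; move: ER_T; rewrite /ER.
set H := gen_subsemigroup _ => ER_T.
have cH : subsemigroup H by apply: gen_subsemigroup_closed.
have mH := subsemigroupP _ cH.
have idemH w : w * s * w = w -> s * w \in H.
  move=> wsw; apply: (subsetP (sub_gen_subsemigroup _)).
  by rewrite !inE /idem -mulgA (mulgA w) wsw eqxx.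
have inT (z : T) : z \in [set: T] by rewrite inE.
have [w [_ /idemH Hf xsw]] := weak_inverse (subsemigroupT T) (inT s) (inT u) xsu.
have [w' [_ /idemH Hg ysw]] := weak_inverse (subsemigroupT T) (inT s) (inT v) ysv.
move: Hf Hg; set f := s * w; set g := s * w' => Hf Hg.
have xf : y * f = x by rewrite mulgA -eqs.
have yg : x * g = y by rewrite mulgA eqs.
clearbody f g.
have [n ee] := idem_power (g * f); set p := spow _ n in ee.
have Hp : p \in H := spow_closed n mH (mH _ _ Hg Hf).
have xp : x * p = x.
  rewrite /p; elim: n {p ee Hp} => [|n IH]; first by rewrite /spow /= mulgA yg.
  by rewrite spowS !mulgA yg xf.
suff pg : p = p * g by rewrite -xp pg mulgA xp yg.
apply: ER_T => //; first exact: mH.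
apply/eqP; rewrite eqEsubset !right_mult1S //.
apply/andP; split; apply/right_mult1P; right; last by exists g.
have [h Hh ph] : exists2 h, h \in H & p = g * h.
  rewrite /p; case: n {p ee Hp xp} => [|n]; first by exists f.
  exists (f * spow (g * f) n); last by rewrite spowS mulgA.
  exact: mH Hf (spow_closed n mH (mH _ _ Hg Hf)).
by exists h; rewrite // -mulgA -ph; apply/esym/eqP.
Qed.

End ERSemigroups.

(** * Semigroups of level-lowering maps *)

Section Flows.
Variables (Q I : finType) (D : Q -> {set I}).

(** The set [D q] is the level of [q]. Levels are compared by inclusion, so that principal right
    ideals can serve as levels and the R-order becomes the order of levels. *)
Definition falling (f : {ffun Q -> Q}) :=
  [forall q, D (f q) \subset D q] &&
  [forall q, forall q', [&& f q == f q', D q \subset D (f q) & D q' \subset D (f q')]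
     ==> (q == q')].

Record flow := Flow { flow_fun :> {ffun Q -> Q}; flowP : falling flow_fun }.
HB.instance Definition _ := [isSub for flow_fun].
HB.instance Definition _ := [Finite of flow by <:].
Implicit Types f g : flow.

Lemma fallingP (f : {ffun Q -> Q}) : reflect
  ((forall q, D (f q) \subset D q) /\
   forall q q', f q = f q' -> D q \subset D (f q) -> D q' \subset D (f q') -> q = q')
  (falling f).
Proof.
apply: (iffP andP) => -[/forallP le_f inj_f]; split=> //.
  move=> q q' eq_f le le'; move: (forallP (forallP inj_f q) q').
  by rewrite -eq_f eqxx le eq_f le' => /eqP.
apply/forallP => q; apply/forallP => q'; apply/implyP => /and3P[/eqP eq_f le le'].
by rewrite (inj_f q q').
Qed.

Lemma falling_comp f g : falling [ffun q => g (f q)].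
Proof.
have [/fallingP[le_f inj_f] /fallingP[le_g inj_g]] := (flowP f, flowP g).
apply/fallingP; split=> [q|q q']; rewrite !ffunE.
  exact: subset_trans (le_g _) (le_f q).
move=> eq_q le le'; apply: inj_f.
- apply: inj_g eq_q _ _.
    exact: subset_trans (le_f q) le.
  exact: subset_trans (le_f q') le'.
- exact: subset_trans le (le_g _).
- exact: subset_trans le' (le_g _).
Qed.

Definition flow_mul f g : flow := Flow (falling_comp f g).

Lemma flow_mulA : associative flow_mul.
Proof. by move=> f g h; apply/val_inj/ffunP => q; rewrite !ffunE. Qed.

HB.instance Definition _ := isSemigroup.Build flow flow_mulA.

Lemma flow_mulE f g q : (f * g) q = g (f q).
Proof. exact: ffunE. Qed.

Lemma flow_le f q : D (f q) \subset D q.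
Proof. by have /fallingP[] := flowP f. Qed.

Lemma flow_inj f q q' :
  f q = f q' -> D q \subset D (f q) -> D q' \subset D (f q') -> q = q'.
Proof. by have /fallingP[_] := flowP f; apply. Qed.

(** [B] consists of the maps fixing every point whose level they keep. An idempotent [e] is in [B]
    because [q] and [e q] have the same image [e q], and [B] is closed under products. If
    [g = f * a] and [f = g * b], then [a] keeps the level of each [f q], hence fixes [f q], and
    [g = f]. *)
Lemma ER_flow : ER flow.
Proof.
pose B := [set f : flow | [forall q, (D q \subset D (f q)) ==> (f q == q)]].
have inB f : reflect (forall q, D q \subset D (f q) -> f q = q) (f \in B).
  rewrite inE; apply: (iffP forallP) => fB q.
    by move=> le; apply/eqP/(implyP (fB q)).
  by apply/implyP => /fB/eqP.
have /subsetP genB : gen_subsemigroup (idempotents [set: flow]) \subset B.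
  apply: gen_subsemigroup_min.
    apply/subsetP => e; rewrite !inE /= => /eqP ee; apply/forallP => q.
    apply/implyP => le; have eeq : e (e q) = e q by rewrite -flow_mulE ee.
    by apply/eqP; apply: (@flow_inj e); rewrite ?eeq.
  apply/subsemigroupP => f g /inB fB /inB gB; apply/inB => q; rewrite flow_mulE => le.
  have fq : f q = q by apply: fB; apply: subset_trans le (flow_le g _).
  by rewrite fq in le *; apply: gB.
move=> f g Hf Hg eq_fg.
have : g \in right_mult1 (gen_subsemigroup (idempotents [set: flow])) f.
  by rewrite eq_fg right_mult1_refl.
have : f \in right_mult1 (gen_subsemigroup (idempotents [set: flow])) g.
  by rewrite -eq_fg right_mult1_refl.
move=> /right_mult1P[//|[b Hb fgb]] /right_mult1P[//|[a /genB/inB aB gfa]].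
apply/val_inj/ffunP => q; rewrite [in RHS]gfa flow_mulE aB //.
by rewrite -flow_mulE -gfa {1}fgb flow_mulE flow_le.
Qed.

End Flows.

(** * ER-pointlike sets *)

Section Pointlikes.
Variable S : finSemigroupType.
Implicit Types (X Y Z E U : powersemi S) (K : {set powersemi S}).

Lemma powersemiME X Y (z : S) :
  reflect (exists x y, [/\ x \in pset X, y \in pset Y & z = x * y]) (z \in pset (X * Y)).
Proof.
apply: (iffP imset2P) => [[x y Xx Yy ->]|[x [y [Xx Yy ->]]]]; first by exists x, y.
by exists x y.
Qed.

Lemma powersemiMS X X' Y Y' :
  pset X \subset pset X' -> pset Y \subset pset Y' -> pset (X * Y) \subset pset (X' * Y').
Proof. exact: imset2S. Qed.

Lemma powersemi1M (s t : S) : powersemi1 s * powersemi1 t = powersemi1 (s * t).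
Proof. by apply/val_inj; rewrite /= imset2_set1l imset_set1. Qed.

(** [Z] can be rewritten as a product of [n] factors [X] and a last factor [Z], all of them inside
    [Y]. *)
Lemma subset_spow X Y Z n :
  pset X \subset pset Y -> pset Z \subset pset Y -> X * Z = Z ->
  pset Z \subset pset (spow Y n).
Proof.
by move=> XY ZY XZ; elim: n => // n IH; rewrite -{1}XZ; apply: powersemiMS.
Qed.

Lemma complexP K : reflect
  [/\ subsemigroup K, forall s, powersemi1 s \in K &
      forall X Y, X \in K -> pset Y \subset pset X -> Y \in K]
  (complex K).
Proof.
apply: (iffP and3P) => -[cK K1 KS]; split=> //.
- exact/forallP.
- by move=> X Y KX; move/forall_inP: KS => /(_ X KX)/forallP/(_ Y)/implyP.
- exact/forallP.
by apply/forall_inP => X KX; apply/forallP => Y; apply/implyP; apply: KS.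
Qed.

Lemma ER_complexP K : reflect
  (complex K /\ forall E, E \in K -> idem E -> exists2 U, U \in K &
     pset U = \bigcup_(X in typeII_class K E) pset X)
  (ER_complex K).
Proof.
apply: (iffP andP) => -[cK KE]; split=> //.
  move=> E E_K EE; move/forall_inP: KE => /(_ E); rewrite inE E_K EE.
  by move=> /(_ isT)/exists_inP[U KU /eqP]; exists U.
apply/forall_inP => E; rewrite inE => /andP[E_K /(KE E E_K)[U KU UE]].
by apply/exists_inP; exists U => //; apply/eqP.
Qed.

(** * Saturated members of an ER-complex *)

Section Saturation.
Variable K : {set powersemi S}.
Hypothesis K_ER : ER_complex K.

Let cK : complex K. Proof. by case/ER_complexP: K_ER. Qed.
Let sK : subsemigroup K. Proof. by case/complexP: cK. Qed.
Let mK : mulg_closed K. Proof. exact/subsemigroupP. Qed.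

Local Notation G := (group_kernel K).
Let GK : {subset G <= K}. Proof. exact: kernel_sub. Qed.
Let mG : mulg_closed G. Proof. exact/subsemigroupP/kernel_closed. Qed.

Let typeII_refl X : typeII K X X. Proof. exact: (typeII_equivalence sK X X X).1. Qed.
Let typeII_trans X Y Z : typeII K X Y -> typeII K Y Z -> typeII K X Z.
Proof. by move=> XY; rewrite ((typeII_equivalence sK X Y Z).2 XY). Qed.

(* [U], the union of the type-II class of a suitable idempotent [E] of the right
   stabilizer of [X], need not lie in the kernel, but its idempotent power does,
   and this power still contains every member of the class of [E]. *)
Lemma absorb X : X \in K -> exists Z, [/\ Z \in K,
  forall Y, typeII K X Y -> pset Y \subset pset Z,
  Z \in right_mult1 K X & X \in right_mult1 K Z -> typeII K X Z].
Proof.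
(* If [X] is alone in its class, [X] itself is the witness. Otherwise a second member [Y0] shows
   that the stabilizer [B] of [X] in the kernel is non-empty. *)
move=> KX; have [/existsP [Y0 /andP[XY0 nY0]]|one] :=
    boolP [exists Y, typeII K X Y && (Y != X)]; last first.
  exists X; split=> //; last exact: right_mult1_refl.
  move=> Y XY; case: (Y =P X) => [->//|/eqP nYX]; case/negP: one.
  by apply/existsP; exists Y; rewrite XY.
pose B := [set C in G | X * C == X].
have inB C : reflect (C \in G /\ X * C = X) (C \in B).
  by rewrite [C \in B]in_set; apply: (iffP andP) => -[? /eqP].
have cB : subsemigroup B.
  apply/subsemigroupP => C C' /inB[GC XC] /inB[GC' XC'].
  by apply/inB; rewrite mulgA XC XC' (mG GC GC').
have classP Y : typeII K X Y -> Y != X ->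
    exists a b, [/\ a \in G, b \in G, Y = X * a & X = Y * b].
  by move=> /typeII_kernel[->|//]; rewrite eqxx.
have [a0 [b0 [Ga0 Gb0 Ya0 Xb0]]] := classP _ XY0 nY0.
have Bab : a0 * b0 \in B by apply/inB; rewrite mulgA -Ya0 -Xb0 (mG Ga0 Gb0).
have [E /inB[GE XE] [EE minE]] := R_minimal_idem cB Bab.
have KE : E \in K := GK GE.
have [_ /(_ E KE EE) [U KU UE]] := ER_complexP _ K_ER.
have subU F : F \in K -> typeII K E F -> pset F \subset pset U.
  by move=> KF EF; rewrite UE (bigcup_sup F) // inE KF.
have [n VV] := idem_power U; set V := spow U n in VV.
have KV : V \in K := spow_closed n mK KU.
have GV : V \in G := idem_kernel KV VV.
have subV F : F \in K -> typeII K E F -> E * F = F -> pset F \subset pset V.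
  by move=> KF EF eF; apply: subset_spow eF; apply: subU.
exists (X * V); split.
- exact: mK.
- move=> Y XY; have [->|nY] := eqVneq Y X.
    rewrite -{1}XE; apply: powersemiMS => //; apply: subV => //; exact/eqP.
  have [a [b [Ga Gb Ya Xb]]] := classP _ XY nY.
  have Bab' : a * b \in B by apply/inB; rewrite mulgA -Ya -Xb (mG Ga Gb).
  (* [Y = X * (E * a)], and [E * a] is type-II equivalent to [E]: multiplying by [b] gives
     [E * (a * b)] with [a * b] in [B], from which R-minimality of [E] leads back to [E]. *)
  rewrite Ya -{1}XE -mulgA; apply: powersemiMS => //; apply: subV.
  + exact: mK (GK GE) (GK Ga).
  + apply/andP; split; apply/right_mult1P; right; first by exists a.
    have /right_mult1P[Eab|[c /inB[Gc _] Eab]] := minE _ Bab'.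
      by exists b; rewrite // -mulgA.
    by exists (b * c); [apply: mG | rewrite {1}Eab !mulgA].
  + by rewrite mulgA (eqP EE).
- by apply/right_mult1P; right; exists V.
move=> XZ; apply/andP; split; first by apply/right_mult1P; right; exists V.
case/right_mult1P: XZ => [XV|[C KC XVC]]; first by apply/right_mult1P; left.
(* [V] is in the kernel, hence so is its local inverse [W] at [X], which leads from [X * V] back to
   [X]. *)
have [W [KW WVW XVW]] := weak_inverse sK KV KC (esym XVC).
apply/right_mult1P; right; exists W => //.
exact: weak_inverse_kernel WVW.
Qed.

Definition saturated Z :=
  (Z \in K) && [forall Y, typeII K Z Y ==> (pset Y \subset pset Z)].

Lemma saturatedP Z : reflect
  (Z \in K /\ forall Y, typeII K Z Y -> pset Y \subset pset Z) (saturated Z).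
Proof.
apply: (iffP andP) => -[KZ satZ]; split=> //.
  by move=> Y; apply/implyP/(forallP satZ).
by apply/forallP => Y; apply/implyP/satZ.
Qed.

(** [absorb] is iterated. Either its result [Z] is type-II equivalent to [X], and then it contains
    its own class and is saturated, or it lies strictly R-below [X] and the principal right ideal
    has shrunk. *)
Lemma saturate X : X \in K -> exists Z, [/\ saturated Z, pset X \subset pset Z,
  Z \in right_mult1 K X & X \in right_mult1 K Z -> typeII K X Z].
Proof.
have [n] := ubnP #|right_mult1 K X|; elim: n X => // n IH X leXn KX.
have [Z [KZ subZ ZX XZ]] := absorb KX; have XsubZ := subZ _ (typeII_refl X).
have [XleZ|XnleZ] := boolP (X \in right_mult1 K Z).
  have XeqZ := XZ XleZ; exists Z; split=> //; apply/saturatedP; split=> // Y ZY.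
  exact: subZ (typeII_trans XeqZ ZY).
have [|W [satW ZW WZ _]] := IH Z _ KZ.
  rewrite ltnS in leXn; apply: leq_trans leXn; apply: proper_card.
  by rewrite properE !right_mult1S // ZX XnleZ.
exists W; split=> //; [exact: subset_trans ZW | exact: right_mult1_trans WZ |].
by move=> XW; case/negP: XnleZ; apply: right_mult1_trans XW.
Qed.

End Saturation.

Lemma PL_sub K : ER_complex K -> PL S ER \subset K.
Proof.
move=> K_ER; have /ER_complexP[/complexP[cK K1 KS] _] := K_ER.
have mK := subsemigroupP _ cK.
(* The maps act on the saturated sets and on a starting point [None], which plays the part of an
   adjoined identity. [None] also belongs to its own level and to no other, which puts it strictly
   above every saturated set. *)
pose sat := {Z | saturated K Z}.
pose D (q : option sat) : {set option (powersemi S)} :=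
  if q is Some Z then [set Some Y | Y in right_mult1 K (val Z)] else setT.
have DS (Z Z' : sat) : (D (Some Z') \subset D (Some Z)) = (val Z' \in right_mult1 K (val Z)).
  rewrite -right_mult1S //; apply/subsetP/subsetP => ZZ' Y.
    by move=> Z'Y; have /ZZ'/imsetP[Y' ? [->]] : Some Y \in D (Some Z') by apply: imset_f.
  by case/imsetP => {}Y Z'Y ->; apply: imset_f; apply: ZZ'.
have DN (Z : sat) : D None \subset D (Some Z) = false.
  by apply/negP => /subsetP/(_ None); rewrite inE => /(_ isT)/imsetP[].
pose act (q : option sat) s :=
  if q is Some Z then val Z * powersemi1 s else powersemi1 s.
(* Containment instead of equality makes [rho] closed under products: a saturation of a product need
   not be obtained by saturating step by step. *)
pose rho : {pred S * flow D} := [pred p : S * flow D | [forall q,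
  [exists Z, (p.2 q == Some Z) && (pset (act q p.1) \subset pset (val Z))]]].
have rhoP (p : S * flow D) : reflect (forall q, exists2 Z, p.2 q = Some Z &
    pset (act q p.1) \subset pset (val Z)) (p \in rho).
  rewrite inE; apply: (iffP forallP) => pP q.
    by have /existsP[Z /andP[/eqP]] := pP q; exists Z.
  by have [Z qZ actZ] := pP q; apply/existsP; exists Z; rewrite qZ eqxx.
have KZ (Z : sat) : val Z \in K by case/saturatedP: (valP Z).
have Kact q s : act q s \in K.
  by case: q => [Z|]; [apply: mK _ _ (KZ Z) (K1 s) | apply: K1].
have rho_rel : relational_morphism [set: S] rho.
  split=> [p _|[s f] [t g] /rhoP/= sf /rhoP/= tg|s _]; first by rewrite inE.
    apply/rhoP => q /=; have [Z qZ actZ] := sf q; have [Z' qZ' actZ'] := tg (Some Z).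
    exists Z'; first by rewrite flow_mulE qZ.
    apply: subset_trans actZ'; have -> : act q (s * t) = act q s * powersemi1 t.
      by case: (q) => [W|] /=; rewrite -powersemi1M ?mulgA.
    exact: powersemiMS.
  have /choice[c cP] q : exists Z : sat, [/\ pset (act q s) \subset pset (val Z),
      val Z \in right_mult1 K (act q s) &
      act q s \in right_mult1 K (val Z) -> typeII K (act q s) (val Z)].
    by have [Z [satZ ? ? ?]] := saturate K_ER (Kact q s); exists (exist _ Z satZ).
  (* If the level of [Z] is kept, then neither multiplication by [s] nor saturation leaves the
     R-class of [Z]. *)
  have stay (Z : sat) : D (Some Z) \subset D (Some (c (Some Z))) ->
      typeII K (val Z * powersemi1 s) (val (c (Some Z))) /\
      exists2 U, U \in K & val Z * powersemi1 s * U = val Z.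
    rewrite DS => Zc; have [_ le_c cII] := cP (Some Z).
    have leZ : val Z \in right_mult1 K (act (Some Z) s) by apply: right_mult1_trans Zc.
    split.
      apply: cII; apply: right_mult1_trans Zc _ => //.
      by apply/right_mult1P; right; exists (powersemi1 s).
    case/right_mult1P: leZ => /= [eZ|[U KU eZ]]; last by exists U.
    by exists (powersemi1 s); rewrite ?K1 -?eZ.
  have fallF : falling D [ffun q => Some (c q)].
    apply/fallingP; split=> [q|q q']; rewrite !ffunE.
      case: q => [Z|]; last exact: subsetT.
      rewrite DS; have [_ le_c _] := cP (Some Z); apply: right_mult1_trans le_c => //.
      by apply/right_mult1P; right; exists (powersemi1 s).
    case=> eq_c; case: q q' eq_c => [Z|] [Z'|] eq_c; rewrite ?DN // => /stay[ZII [U KU ZU]].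
    move=> /stay[Z'II [U' KU' ZU']]; rewrite -eq_c in Z'II.
    have eq_r := typeII_equivalence cK.
    (* Both products are equivalent to their common saturation. Stability cancels [s], and two
       equivalent saturated sets contain each other. *)
    have ZsZ's : typeII K (val Z * powersemi1 s) (val Z' * powersemi1 s).
      by rewrite ((eq_r _ _ _).2 ZII) /typeII andbC.
    have ZZ' : typeII K (val Z) (val Z').
      by rewrite (@stable_typeII _ _ cK _ _ (powersemi1 s) U U').
    have Z'Z : typeII K (val Z') (val Z) by rewrite /typeII andbC.
    congr Some; apply/val_inj/val_inj/eqP; rewrite eqEsubset.
    have /saturatedP[_ satZ] := valP Z; have /saturatedP[_ satZ'] := valP Z'.
    by rewrite satZ' ?satZ.
  exists (Flow fallF); apply/rhoP => q; exists (c q); first exact: ffunE.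
  by have [] := cP q.
apply/subsetP => X; rewrite inE => /asboolP /(_ _ rho (@ER_flow _ _ D) rho_rel) [f fX].
(* All elements of [X] are related to the same [f], so the single member of [K] given by [f None]
   contains each of them. *)
have [x Xx] := set0Pn _ (pset_neq0 X).
have [Z fZ _] := rhoP _ (fX x Xx) None.
apply: KS (KZ Z) _; apply/subsetP => y Xy.
have [Z' fZ'] := rhoP _ (fX y Xy) None; move: fZ'; rewrite /= fZ => -[<-].
by rewrite sub1set.
Qed.

Lemma PL_complex V : complex (PL S V).
Proof.
apply/complexP; split.
- apply/subsemigroupP => X Y; rewrite !inE => /asboolP ptX /asboolP ptY.
  apply/asboolP => T rho VT rhoP.
  have [[v Xv] [w Yw]] := (ptX T rho VT rhoP, ptY T rho VT rhoP).
  exists (v * w) => _ /powersemiME[x [y [Xx Yy ->]]].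
  exact: relational_mul rhoP (Xv x Xx) (Yw y Yy).
- move=> s; rewrite inE; apply/asboolP => T rho _ [_ _ /(_ s)[|v sv]] //.
  by exists v => x /set1P->.
move=> X Y; rewrite !inE => /asboolP ptX /subsetP YX; apply/asboolP => T rho VT rhoP.
by have [v Xv] := ptX T rho VT rhoP; exists v => y /YX/Xv.
Qed.

Lemma PL_ER_complex : ER_complex (PL S ER).
Proof.
have cP := PL_complex ER; have [sP _ _] := complexP _ cP.
apply/ER_complexP; split=> // E PE EE.
set W := \bigcup_(X in _) _.
have sub_W X : X \in typeII_class (PL S ER) E -> pset X \subset W by apply: bigcup_sup.
have W0 : W != set0.
  have [x Ex] := set0Pn _ (pset_neq0 E); apply/set0Pn; exists x.
  apply: (subsetP (sub_W E _)) => //; rewrite inE PE /=.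
  exact: (typeII_equivalence sP E E E).1.
exists (PowerSemi W0) => //; rewrite inE; apply/asboolP => T rho ER_T rho_rel.
(* [rho'] lifts [rho] to pointlike sets, a set being related to [t] when all of its elements are.
   Composing it with a group relation [sigma] for [T] gives [tau], by which the kernel of [PL S ER]
   is tested. *)
pose rho' : {pred powersemi S * T} := [pred p : powersemi S * T |
  (p.1 \in PL S ER) && [forall x in pset p.1, (x, p.2) \in rho]].
have rho'P X t : reflect (X \in PL S ER /\ forall x, x \in pset X -> (x, t) \in rho)
    ((X, t) \in rho').
  by apply: (iffP andP) => -[PX /forall_inP].
have rho'_mul X Y t u : (X, t) \in rho' -> (Y, u) \in rho' -> (X * Y, t * u) \in rho'.
  move=> /rho'P[PX Xt] /rho'P[PY Yu]; apply/rho'P.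
  split=> [|_ /powersemiME[x [y [Xx Yy ->]]]]; first exact: subsemigroupP sP _ _ _ _.
  exact: relational_mul rho_rel (Xt x Xx) (Yu y Yy).
have eqT : {in [set: T] & &, equivalence_rel eq_op} by move=> x y z _ _ _; split=> // /eqP->.
have [G [sigma [sigma_rel sigma1]]] := stable_label (subsemigroupT T) eqT (ER_stable_eq ER_T).
pose tau : {pred powersemi S * G} := [pred p : powersemi S * G |
  [exists t, ((p.1, t) \in rho') && ((t, p.2) \in sigma)]].
have tauP X g : reflect (exists2 t, (X, t) \in rho' & (t, g) \in sigma) ((X, g) \in tau).
  by apply: (iffP exists_inP) => /= -[u]; exists u.
have tau_rel : relational_morphism (PL S ER) tau.
  split=> [[X g] /tauP[t /rho'P[]]//|[X g] [Y h] /tauP[t Xt tg] /tauP[u Yu uh]|X PX].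
    apply/tauP; exists (t * u); first exact: rho'_mul.
    exact: relational_mul sigma_rel tg uh.
  have /asboolP /(_ T rho ER_T rho_rel)[t Xt] : `[< pointlike ER X >] by rewrite inE in PX.
  have [_ _ /(_ t)[|g tg]] := sigma_rel; first by rewrite inE.
  by exists g; apply/tauP; exists t => //; apply/rho'P.
(* A kernel element is related by [tau] to [1], hence by [rho'] to some [t] that fixes every element
   it keeps in its R-class. *)
have kerP A : A \in group_kernel (PL S ER) -> exists2 t, (A, t) \in rho' &
    forall x u, x * t * u = x -> x * t = x.
  move=> /group_kernelP[_ /(_ _ _ tau_rel)/tauP[t At t1]]; exists t => // x u xtu.
  by apply/esym/eqP/(sigma1 t t1 x u); rewrite ?inE.
have [t0 Et0] : exists t, (E, t) \in rho'.
  by have [_ _ /(_ E PE)[g /tauP[t]]] := tau_rel; exists t.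
have [t Et mint] := R_minimal (P := fun t => (E, t) \in rho') (subsemigroupT T) Et0.
exists t => x /bigcupP[Y]; rewrite inE => /andP[_ /typeII_kernel[->|]] //.
  by move=> Ex; case/rho'P: Et => _; apply.
move=> [A [B [/kerP[a Aa a1] /kerP[b Bb _] YA EB]]] Yx.
have Yta : (Y, t * a) \in rho' by rewrite YA; apply: rho'_mul.
suff ta : t * a = t by move: Yta; rewrite ta => /rho'P[_]; apply.
(* [E = E * A * B] is also related to [t * a * b], so minimality of [t] shows that [a] keeps [t] in
   its R-class, and therefore fixes it. *)
have /right_mult1P[tab|[c _ tabc]] : t \in right_mult1 [set: T] (t * a * b).
- apply: mint; first by rewrite EB; apply: rho'_mul.
  by apply/right_mult1P; right; exists (a * b); rewrite ?inE // mulgA.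
- by apply: (a1 t b).
by apply: (a1 t (b * c)); rewrite mulgA.
Qed.

Theorem PL_ER_eq : PL S ER = C_ER S.
Proof.
apply/eqP; rewrite eqEsubset; apply/andP; split; last exact: bigcap_inf PL_ER_complex.
by apply/bigcapsP => K; apply: PL_sub.
Qed.

End Pointlikes.

Local Close Scope group_scope.
Local Open Scope nat_scope.

(** * Computable functions on lists *)

(* Quantifying over all tuples with underlying list [l] hides the proofs of the
   length conditions. *)
Definition runs n (r : recfun n) (l : seq nat) (y : nat) :=
  forall v : n.-tuple nat, tval v = l -> computes r v y.

Lemma runs_comp m n (r : recfun m) (rs : seq (recfun n)) l w y :
  size w = m -> (forall i, i < m -> runs (nth (RZero n) rs i) l (nth 0 w i)) ->
  runs r w y -> runs (RComp r (fun i => nth (RZero n) rs i)) l y.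
Proof.
move=> /eqP sw rsP rP v vl; exists (Tuple sw); last exact: rP.
by move=> i; rewrite (tnth_nth 0); apply: rsP.
Qed.

Lemma runs_prec n (r : recfun n) r' l k (F : nat -> nat) :
  runs r l (F 0) -> (forall i, i < k -> runs r' [:: i, F i & l] (F i.+1)) ->
  runs (RPrec r r') (k :: l) (F k).
Proof.
move=> rP r'P v vl /=; have -> : thead v = k by rewrite /thead (tnth_nth 0) vl.
have {}vl : behead v = l by rewrite vl.
elim: k r'P vl => [|k IH] r'P vl /=; first exact: rP.
exists (F k); first by apply: IH => // i ik; apply: r'P; apply: leqW.
by apply: r'P => //=; rewrite vl.
Qed.

Lemma runs_mu n (r : recfun n.+1) l y :
  runs r (y :: l) 0 -> (forall z, z < y -> exists u, runs r (z :: l) u.+1) ->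
  runs (RMu r) l y.
Proof.
move=> r0 rS v vl /=; split; first by apply: r0; rewrite /= vl.
by move=> z /rS[u ru]; exists u; apply: ru; rewrite /= vl.
Qed.

Definition rec n (f : seq nat -> nat) :=
  exists r : recfun n, forall l, size l = n -> runs r l (f l).

Lemma rec_ext n f g : (forall l, size l = n -> f l = g l) -> rec n f -> rec n g.
Proof. by move=> fg [r rP]; exists r => l sl; rewrite -fg //; apply: rP. Qed.

Lemma rec_zero n : rec n (fun _ => 0).
Proof. by exists (RZero n) => l _ v. Qed.

Lemma rec_var n i : i < n -> rec n (fun l => nth 0 l i).
Proof.
move=> lt_in; exists (RProj (Ordinal lt_in)) => l _ v <- /=.
by rewrite (tnth_nth 0).
Qed.

Lemma rec_comp m n g (hs : seq (seq nat -> nat)) : rec m g -> size hs = m ->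
  (forall i, i < m -> rec n (nth (fun _ => 0) hs i)) ->
  rec n (fun l => g [seq h l | h <- hs]).
Proof.
move=> [r rP] shs hsP.
have [rs srs rsP] : exists2 rs : seq (recfun n), size rs = m & forall i, i < m ->
    forall l, size l = n -> runs (nth (RZero n) rs i) l (nth (fun _ => 0) hs i l).
  have /choice[R RP] (i : 'I_m) := hsP i (ltn_ord i).
  exists [seq R i | i <- enum 'I_m]; first by rewrite size_map size_enum_ord.
  move=> i im; rewrite (nth_map (Ordinal im)) ?size_enum_ord //.
  by rewrite (nth_ord_enum (Ordinal im) (Ordinal im)); apply: RP.
exists (RComp r (fun i => nth (RZero n) rs i)) => l sl.
apply: (@runs_comp _ _ _ _ _ [seq h l | h <- hs]); first by rewrite size_map.
  by move=> i im; rewrite (nth_map (fun _ => 0)) ?shs //; apply: rsP.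
by apply: rP; rewrite size_map.
Qed.

Lemma rec_comp1 n g h : rec 1 g -> rec n h -> rec n (fun l => g [:: h l]).
Proof. by move=> rg rh; apply: (rec_comp (hs := [:: h]) rg) => // -[]. Qed.

(** The ignored arguments come first, where minimization puts its candidate and primitive recursion
    its counter and accumulator. *)
Lemma rec_drop k n f : rec n f -> rec (k + n) (fun l => f (drop k l)).
Proof.
move=> rf; apply: rec_ext (rec_comp
  (hs := [seq (fun l => nth 0 l (k + i)) | i <- iota 0 n]) rf _ _).
- move=> l sl; congr f; rewrite -map_comp; apply: (@eq_from_nth _ 0).
    by rewrite size_map size_iota size_drop sl addKn.
  rewrite size_map size_iota => i lt_in.
  by rewrite (nth_map 0) ?size_iota // nth_iota //= nth_drop.
- by rewrite size_map size_iota.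
move=> i lt_in; rewrite (nth_map 0) ?size_iota // nth_iota //=.
by apply: rec_var; rewrite ltn_add2l.
Qed.

Lemma rec_succ n f : rec n f -> rec n (fun l => (f l).+1).
Proof.
apply: (rec_comp1 (g := fun l => (nth 0 l 0).+1)).
by exists RSucc => l _ v <- /=; rewrite /thead (tnth_nth 0).
Qed.

Lemma rec_const n c : rec n (fun _ => c).
Proof. by elim: c => [|c]; [apply: rec_zero | apply: rec_succ]. Qed.

Lemma rec_prec n z h k : rec n z -> rec n.+2 h -> rec n k ->
  rec n (fun l => nat_rect _ (z l) (fun i a => h [:: i, a & l]) (k l)).
Proof.
move=> [rz zP] [rh hP] rk.
pose F l := nat_rect (fun=> nat) (z (behead l)) (fun i a => h [:: i, a & behead l]) (head 0 l).
have rF : rec n.+1 F.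
  exists (RPrec rz rh) => -[|m l] //= [sl]; rewrite /F /=.
  apply: (@runs_prec _ _ _ _ _ (nat_rect (fun=> nat) (z l) (fun i a => h [:: i, a & l]))).
    exact: zP.
  by move=> i _; apply: hP; rewrite /= sl.
apply: rec_ext (rec_comp (hs := k :: [seq (fun l => nth 0 l i) | i <- iota 0 n]) rF _ _).
- move=> l sl; rewrite /F /=;
  have -> // : [seq h l | h <- [seq (nth 0)^~ i | i <- iota 0 n]] = l.
  by rewrite -map_comp -[RHS](mkseq_nth 0) sl.
- by rewrite /= size_map size_iota.
case=> [|i] // lt_in; rewrite /= (nth_map 0) ?size_iota // nth_iota //.
exact: rec_var.
Qed.

Lemma rec_mu n f m : rec n.+1 f ->
  (forall l, size l = n -> f (m l :: l) = 0 /\ forall z, z < m l -> 0 < f (z :: l)) ->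
  rec n m.
Proof.
move=> [r rP] mP; exists (RMu r) => l sl; have [m0 mS] := mP l sl.
apply: runs_mu => [|z /mS fz]; first by rewrite -m0; apply: rP; rewrite /= sl.
by exists (f (z :: l)).-1; rewrite prednK //; apply: rP; rewrite /= sl.
Qed.

Lemma rec_pred n f : rec n f -> rec n (fun l => (f l).-1).
Proof.
move=> rf; apply: rec_ext (rec_prec (rec_zero n) (@rec_var n.+2 0 isT) rf).
by move=> l _; case: (f l).
Qed.

Lemma rec_add n f g : rec n f -> rec n g -> rec n (fun l => f l + g l).
Proof.
move=> rf rg; apply: rec_ext (rec_prec rg (rec_succ (@rec_var n.+2 1 isT)) rf).
by move=> l _; elim: (f l) => //= k ->.
Qed.

Lemma rec_sub n f g : rec n f -> rec n g -> rec n (fun l => f l - g l).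
Proof.
move=> rf rg; apply: rec_ext (rec_prec rf (rec_pred (@rec_var n.+2 1 isT)) rg).
by move=> l _; elim: (g l) => [|k] /=; rewrite ?subn0 // subnS => ->.
Qed.

Lemma rec_mul n f g : rec n f -> rec n g -> rec n (fun l => f l * g l).
Proof.
move=> rf rg; apply: rec_ext (rec_prec (rec_zero n)
  (rec_add (@rec_drop 2 n g rg) (@rec_var n.+2 1 isT)) rf).
by move=> l _; elim: (f l) => //= k ->; rewrite mulSn drop0.
Qed.

Lemma rec_exp2 n f : rec n f -> rec n (fun l => 2 ^ f l).
Proof.
move=> rf; have r1 := @rec_var n.+2 1 isT.
apply: rec_ext (rec_prec (rec_const n 1) (rec_add r1 r1) rf).
by move=> l _; elim: (f l) => //= k ->; rewrite expnS mul2n addnn.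
Qed.

(** The recursion is [k.+1./2 = k - k./2]. *)
Lemma rec_half n f : rec n f -> rec n (fun l => (f l)./2).
Proof.
move=> rf; apply: rec_ext (rec_prec (rec_zero n)
  (rec_sub (@rec_var n.+2 0 isT) (@rec_var n.+2 1 isT)) rf).
move=> l _; elim: (f l) => //= k ->.
by rewrite uphalf_half -{1}(odd_double_half k); lia.
Qed.

Lemma rec_iter_half n f g : rec n f -> rec n g -> rec n (fun l => iter (g l) half (f l)).
Proof.
move=> rf rg; apply: rec_ext (rec_prec rf (rec_half (@rec_var n.+2 1 isT)) rg).
by move=> l _; elim: (g l) => //= k ->.
Qed.

(** * Arithmetic of list codes *)

Definition code_cons a c := 2 ^ a * c.*2.+1.
(** [code_cons] is the step by which [CodeSeq.code] codes a list: the head is the exponent of 2, and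
    halving the odd part leaves the code of the tail. *)
Definition code_tail c := (iter (logn 2 c) half c)./2.

Lemma rec_code_cons n f g : rec n f -> rec n g -> rec n (fun l => code_cons (f l) (g l)).
Proof.
move=> rf rg; apply: rec_ext (rec_mul (rec_exp2 rf) (rec_succ (rec_add rg rg))).
by move=> l _; rewrite addnn.
Qed.

Lemma code_case c : c = 0 \/ exists a m, c = code_cons a m.
Proof.
rewrite -(CodeSeq.decodeK c); case: (CodeSeq.decode c) => [|a s]; first by left.
by right; exists a, (CodeSeq.code s).
Qed.

Lemma iter_half_cons a m k : iter k half (code_cons (k + a) m) = code_cons a m.
Proof.
elim: k a => // k IH a; rewrite addSnnS iterS IH /code_cons expnS -mulnA mul2n.
exact: doubleK.
Qed.

Lemma logn_cons a m : logn 2 (code_cons a m) = a.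
Proof.
by rewrite /code_cons lognM ?expn_gt0 // pfactorK // lognE dvdn2 /= odd_double addn0.
Qed.

Lemma code_tail_cons a m : code_tail (code_cons a m) = m.
Proof.
by rewrite /code_tail logn_cons -{2}[a]addn0 iter_half_cons /code_cons mul1n /= uphalf_double.
Qed.

Lemma rec_logn2 n f : rec n f -> rec n (fun l => logn 2 (f l)).
Proof.
(* [h z c] vanishes when [c] halved [z] times is odd, so the least zero is the exponent of 2. The
   factor [c] stops the search at once for [c = 0], in agreement with [logn 2 0 = 0]. *)
pose h z c := (1 - (iter z half c - ((iter z half c)./2 + (iter z half c)./2))) * c.
move=> rf; apply: (@rec_mu n (fun l => h (nth 0 l 0) (f (drop 1 l)))).
  have r0 := @rec_var n.+1 0 isT; have rf1 := @rec_drop 1 n f rf.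
  have ri := rec_iter_half rf1 r0; have rh := rec_half ri.
  exact: rec_mul (rec_sub (rec_const _ 1) (rec_sub ri (rec_add rh rh))) rf1.
have hE z c : h z c = ~~ odd (iter z half c) * c.
  rewrite /h; congr (_ * _); rewrite addnn -{1}[iter z half c]odd_double_half addnK.
  by case: odd.
move=> l _; rewrite /= drop0; have [->|[a [m ->]]] := code_case (f l).
  by rewrite !hE !muln0.
rewrite logn_cons hE -{2}[a]addn0 iter_half_cons /code_cons mul1n /= odd_double.
split=> // z lt_za; rewrite hE -{1}(subnKC (ltnW lt_za)) iter_half_cons.
rewrite /code_cons oddM oddX subn_eq0 [a <= z]leqNgt lt_za /=.
by rewrite mul1n muln_gt0 expn_gt0.
Qed.

Lemma rec_code_tail n f : rec n f -> rec n (fun l => code_tail (f l)).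
Proof. by move=> rf; apply/rec_half/rec_iter_half/rec_logn2. Qed.

Definition code_drop k c := iter k code_tail c.

Lemma rec_code_drop n f g : rec n f -> rec n g -> rec n (fun l => code_drop (g l) (f l)).
Proof.
move=> rf rg; apply: rec_ext (rec_prec rf (rec_code_tail (@rec_var n.+2 1 isT)) rg).
by move=> l _; elim: (g l) => //= k ->.
Qed.

Lemma code_drop_code k s : code_drop k (CodeSeq.code s) = CodeSeq.code (drop k s).
Proof.
elim: k s => [|k IH] [|a s] //; rewrite /code_drop iterSr.
  have -> : code_tail (CodeSeq.code [::]) = 0 by rewrite /code_tail logn0.
  exact: (IH [::]).
rewrite -[CodeSeq.code _]/(code_cons a (CodeSeq.code s)) code_tail_cons.
exact: IH.
Qed.

Lemma logn_code s : logn 2 (CodeSeq.code s) = head 0 s.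
Proof. by case: s => //= a s; apply: logn_cons. Qed.

(** This counts the [k] below [c] for which dropping [k] entries leaves a non-zero code,
    [1 - (1 - m)] being the indicator of [m > 0]. The bound [c] suffices because a list is no longer
    than its code. *)
Definition code_size c :=
  nat_rect (fun=> nat) 0 (fun k m => m + (1 - (1 - code_drop k c))) c.

Lemma leq_size_code s : size s <= CodeSeq.code s.
Proof.
elim: s => //= a s IH; apply: leq_trans (leq_pmull _ _); last by rewrite expn_gt0.
by rewrite ltnS -addnn (leq_trans IH) ?leq_addr.
Qed.

Lemma code_sizeE s : code_size (CodeSeq.code s) = size s.
Proof.
have stepE k : (1 - (1 - code_drop k (CodeSeq.code s))) = (k < size s) :> nat.
  rewrite code_drop_code -subn_gt0 -size_drop; case: (drop k s) => //= a s'.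
  by case E: (_ * _) => // ; move/eqP: E; rewrite muln_eq0 expn_eq0.
rewrite /code_size -[RHS](minn_idPl (leq_size_code s)).
elim: {2 3}(CodeSeq.code s) => [|k /= ->]; first by rewrite minn0.
by rewrite stepE; lia.
Qed.

Lemma rec_code_size n f : rec n f -> rec n (fun l => code_size (f l)).
Proof.
move=> rf; have rd := rec_code_drop (rec_drop 2 rf) (@rec_var n.+2 0 isT).
have r1 k := rec_const k 1.
apply: rec_ext (rec_prec (rec_zero n) (rec_add (@rec_var n.+2 1 isT)
  (rec_sub (r1 _) (rec_sub (r1 _) rd))) rf).
by move=> l _; rewrite /code_size; elim: {1 3}(f l) => //= k ->; rewrite drop0.
Qed.

(** * Computable functions between countable types *)

Definition computable (A B : countType) (f : A -> B) :=
  exists r : recfun 1, forall a, runs r [:: pickle a] (pickle (f a)).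

Section Computable.
Variable X : countType.

Lemma runs_comp1 n (r : recfun 1) (r1 : recfun n) l x y :
  runs r1 l x -> runs r [:: x] y ->
  runs (RComp r (fun i => nth (RZero n) [:: r1] i)) l y.
Proof. by move=> r1P; apply: runs_comp => // -[]. Qed.

Lemma computable_rec1 (A B : countType) (F : A -> B) g (f : X -> A) :
  rec 1 (fun l => g (nth 0 l 0)) -> (forall a, pickle (F a) = g (pickle a)) ->
  computable f -> computable (fun x => F (f x)).
Proof.
move=> [rg gP] Fg [rf fP]; exists (RComp rg (fun i => nth (RZero 1) [:: rf] i)) => x.
by apply: runs_comp1 (fP x) _; rewrite Fg; apply: gP.
Qed.

Lemma computable_rec2 (A B C : countType) (F : A -> B -> C) g (f : X -> A) (f' : X -> B) :
  rec 2 (fun l => g (nth 0 l 0) (nth 0 l 1)) ->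
  (forall a b, pickle (F a b) = g (pickle a) (pickle b)) ->
  computable f -> computable f' -> computable (fun x => F (f x) (f' x)).
Proof.
move=> [rg gP] Fg [rf fP] [rf' fP'].
exists (RComp rg (fun i => nth (RZero 1) [:: rf; rf'] i)) => x.
apply: (@runs_comp _ _ _ _ _ [:: pickle (f x); pickle (f' x)]) => //.
  by case=> [|[]].
by rewrite Fg; apply: gP.
Qed.

Lemma computable_rec3 (A B C D : countType) (F : A -> B -> C -> D) g
    (f : X -> A) (f' : X -> B) (f'' : X -> C) :
  rec 3 (fun l => g (nth 0 l 0) (nth 0 l 1) (nth 0 l 2)) ->
  (forall a b c, pickle (F a b c) = g (pickle a) (pickle b) (pickle c)) ->
  computable f -> computable f' -> computable f'' ->
  computable (fun x => F (f x) (f' x) (f'' x)).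
Proof.
move=> [rg gP] Fg [rf fP] [rf' fP'] [rf'' fP''].
exists (RComp rg (fun i => nth (RZero 1) [:: rf; rf'; rf''] i)) => x.
apply: (@runs_comp _ _ _ _ _ [:: pickle (f x); pickle (f' x); pickle (f'' x)]) => //.
  by case=> [|[|[]]].
by rewrite Fg; apply: gP.
Qed.

Lemma computable_id : computable (fun x : X => x).
Proof. by exists (RProj ord0) => x v vl /=; rewrite (tnth_nth 0) vl. Qed.

Lemma computable_const (A : countType) (a : A) : computable (fun _ : X => a).
Proof. by have [r rP] := rec_const 1 (pickle a); exists r => x; apply: rP. Qed.

Lemma computable_pair (A B : countType) (f : X -> A) (g : X -> B) :
  computable f -> computable g -> computable (fun x => (f x, g x)).
Proof.
apply: (computable_rec2 (F := pair) (g := fun a b => code_cons a (code_cons b 0))) => //.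
by do ![apply: rec_code_cons | apply: rec_zero | apply: rec_var].
Qed.

Lemma computable_fst (A B : countType) (f : X -> A * B) :
  computable f -> computable (fun x => (f x).1).
Proof.
apply: (computable_rec1 (F := fst) (g := logn 2)); first exact/rec_logn2/rec_var.
by case=> a b; rewrite logn_cons.
Qed.

Lemma computable_snd (A B : countType) (f : X -> A * B) :
  computable f -> computable (fun x => (f x).2).
Proof.
apply: (computable_rec1 (F := snd) (g := fun c => logn 2 (code_tail c))).
  exact/rec_logn2/rec_code_tail/rec_var.
by case=> a b; rewrite code_tail_cons logn_cons.
Qed.

Lemma computable_cons (A : countType) (f : X -> A) (g : X -> seq A) :
  computable f -> computable g -> computable (fun x => f x :: g x).
Proof.
apply: (computable_rec2 (F := cons) (g := code_cons)) => //.
by apply: rec_code_cons; apply: rec_var.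
Qed.

(** Reading beyond the end of a coded list gives the number 0, so the default value must have code
    0. *)
Lemma computable_nth (A : countType) (a0 : A) (f : X -> seq A) (g : X -> nat) :
  pickle a0 = 0 ->
  computable f -> computable g -> computable (fun x => nth a0 (f x) (g x)).
Proof.
move=> a00; apply: (computable_rec2 (F := nth a0) (g := fun c k => logn 2 (code_drop k c))).
  by apply: rec_logn2; apply: rec_code_drop; apply: rec_var.
move=> s k; rewrite [pickle s]/(CodeSeq.code _) code_drop_code logn_code -nth0 nth_drop addn0.
have [ltks|leks] := ltnP k (size s); first by rewrite (nth_map a0).
by rewrite !nth_default ?size_map.
Qed.

Lemma computable_size (A : countType) (f : X -> seq A) :
  computable f -> computable (fun x => size (f x)).
Proof.
apply: (computable_rec1 (F := size) (g := code_size)).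
  exact/rec_code_size/rec_var.
by move=> s; rewrite [pickle s]/(CodeSeq.code _) code_sizeE size_map.
Qed.

Lemma computable_if (A : countType) (b : X -> bool) (f g : X -> A) :
  computable b -> computable f -> computable g ->
  computable (fun x => if b x then f x else g x).
Proof.
apply: (computable_rec3 (F := fun b a a' => if b then a else a')
  (g := fun b a a' => b * a + (1 - b) * a')).
  by do ![apply: rec_add | apply: rec_sub | apply: rec_mul | apply: rec_const | apply: rec_var].
by case=> a a'; rewrite ?mul1n ?addn0.
Qed.

Lemma computable_eq (A : countType) (f g : X -> A) :
  computable f -> computable g -> computable (fun x => f x == g x).
Proof.
apply: (computable_rec2 (F := fun a b => a == b) (g := fun a b => 1 - ((a - b) + (b - a)))).
  by do ![apply: rec_add | apply: rec_sub | apply: rec_const | apply: rec_var].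
move=> a b; rewrite [pickle (_ == _)]/(nat_of_bool _) -(inj_eq (pcan_inj (@pickleK A))).
by case: eqP => [->|]; lia.
Qed.

Lemma computable_andb (f g : X -> bool) :
  computable f -> computable g -> computable (fun x => f x && g x).
Proof. by move=> cf cg; apply: computable_if => //; apply: computable_const. Qed.

Lemma computable_implb (f g : X -> bool) :
  computable f -> computable g -> computable (fun x => f x ==> g x).
Proof. by move=> cf cg; apply: computable_if => //; apply: computable_const. Qed.

Lemma computable_orb (f g : X -> bool) :
  computable f -> computable g -> computable (fun x => f x || g x).
Proof. by move=> cf cg; apply: computable_if => //; apply: computable_const. Qed.

Lemma computable_negb (f : X -> bool) :
  computable f -> computable (fun x => ~~ f x).
Proof. by move=> cf; apply: computable_if => //; apply: computable_const. Qed.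

End Computable.

Lemma computable_ext (A B : countType) (f g : A -> B) :
  f =1 g -> computable f -> computable g.
Proof. by move=> fg [r rP]; exists r => a; rewrite -fg. Qed.

Lemma computable_comp (A B C : countType) (g : B -> C) (f : A -> B) :
  computable g -> computable f -> computable (fun a => g (f a)).
Proof.
move=> [rg gP] [rf fP]; exists (RComp rg (fun i => nth (RZero 1) [:: rf] i)) => a.
exact: runs_comp1 (fP a) (gP _).
Qed.

Section ComputableLists.
Variable X : countType.

(* The number of iterations is the exact length of the list, since [h] is only
   known to be computed on codes of elements of [A]. *)
Lemma computable_foldl (A B : countType) (l : X -> seq A) (z : X -> B) h :
  computable l -> computable z ->
  computable (fun p : X * B * A => h p.1.1 p.1.2 p.2) ->
  computable (fun x => foldl (h x) (z x) (l x)).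
Proof.
move=> cl [rz zP] [rh hP]; have [rs sP] := computable_size cl; case: cl => rl lP.
(* From [k] and the codes of [b], [x] and the list, [F] assembles the code of [(x, b, a)], where [a]
   is the entry at position [k]. *)
pose F (l : seq nat) := let k := nth 0 l 0 in let b := nth 0 l 1 in let x := nth 0 l 2 in
  code_cons (code_cons x (code_cons b 0))
    (code_cons (logn 2 (code_drop k (nth 0 l 3))) 0).
have [rF FP] : rec 4 F.
  by do ![apply: rec_code_cons | apply: rec_logn2 | apply: rec_code_drop
         | apply: rec_zero | apply: rec_var].
have [[p0 P0] [p1 P1] [p2 P2]] :=
  And3 (@rec_var 3 0 isT) (@rec_var 3 1 isT) (@rec_var 3 2 isT).
have [i1 I1] := @rec_var 1 0 isT.
pose rc n (r1 : recfun n) (r : recfun 1) := RComp r (fun i => nth (RZero n) [:: r1] i).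
pose ra := RComp rF (fun i => nth (RZero 3) [:: p0; p1; p2; rc _ p2 rl] i).
pose rr := RPrec rz (rc _ ra rh).
exists (RComp rr (fun i => nth (RZero 1) [:: rs; i1] i)) => x.
apply: (@runs_comp _ _ _ _ _ [:: size (l x); pickle x]) => //.
  by case=> [|[|//]] _; [apply: sP | apply: (I1 [:: _])].
rewrite -[X in foldl _ _ X]take_size.
apply: (@runs_prec _ _ _ _ _ (fun k => pickle (foldl (h x) (z x) (take k (l x))))).
  by rewrite take0.
move=> k lt_k; have [a _] : exists a : A, True.
  by move: lt_k; case: (l x) => // a; exists a.
rewrite (take_nth a) // foldl_rcons; set b := foldl _ _ _.
apply: runs_comp1 (hP (x, b, nth a (l x) k)).
apply: (@runs_comp _ _ _ _ _ [:: k; pickle b; pickle x; pickle (l x)]) => //.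
  case=> [|[|[|[|//]]]] _; [exact: P0 [:: _; _; _] _ | exact: P1 [:: _; _; _] _ | |].
    exact: P2 [:: _; _; _] _.
  exact: runs_comp1 (P2 [:: _; _; _] erefl) (lP x).
have -> : pickle (x, b, nth a (l x) k) = F [:: k; pickle b; pickle x; pickle (l x)].
  rewrite /F /= [in RHS]/(pickle (l x)) /=.
  rewrite code_drop_code logn_code -nth0 nth_drop addn0 (nth_map a) //.
exact: FP.
Qed.

Lemma computable_rev (A : countType) (l : X -> seq A) :
  computable l -> computable (fun x => rev (l x)).
Proof.
move=> cl; apply: (@computable_ext _ _ (fun x => foldl (fun s a => a :: s) [::] (l x))).
  by move=> x; rewrite -[l x in LHS]revK foldl_rev; elim: (rev _) => //= a s ->.
apply: computable_foldl => //; first exact: computable_const.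
apply: computable_cons; first exact/computable_snd/computable_id.
exact/computable_snd/computable_fst/computable_id.
Qed.

Lemma computable_foldr (A B : countType) (l : X -> seq A) (z : X -> B) h :
  computable l -> computable z ->
  computable (fun p : X * A * B => h p.1.1 p.1.2 p.2) ->
  computable (fun x => foldr (h x) (z x) (l x)).
Proof.
move=> cl cz ch.
apply: (@computable_ext _ _ (fun x => foldl (fun b a => h x a b) (z x) (rev (l x)))).
  by move=> x; rewrite foldl_rev.
apply: computable_foldl => //; first exact: computable_rev.
apply: (computable_comp (f := fun p : X * B * A => (p.1.1, p.2, p.1.2)) ch).
have cid := computable_id (X * B * A)%type; have c1 := computable_fst cid.
apply: computable_pair; last exact: computable_snd c1.
by apply: computable_pair; [apply: computable_fst c1 | apply: computable_snd cid].
Qed.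

Lemma computable_all (A : countType) (l : X -> seq A) (p : X -> A -> bool) :
  computable l -> computable (fun q : X * A => p q.1 q.2) ->
  computable (fun x => all (p x) (l x)).
Proof.
move=> cl cp.
apply: (@computable_ext _ _ (fun x => foldr (fun a b => p x a && b) true (l x))).
  by move=> x; elim: (l x) => //= a s ->.
apply: computable_foldr => //; first exact: computable_const.
have cid := computable_id (X * A * bool)%type.
exact: computable_andb (computable_comp cp (computable_fst cid)) (computable_snd cid).
Qed.

Lemma computable_has (A : countType) (l : X -> seq A) (p : X -> A -> bool) :
  computable l -> computable (fun q : X * A => p q.1 q.2) ->
  computable (fun x => has (p x) (l x)).
Proof.
move=> cl cp.
apply: (@computable_ext _ _ (fun x => foldr (fun a b => p x a || b) false (l x))).
  by move=> x; elim: (l x) => //= a s ->.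
apply: computable_foldr => //; first exact: computable_const.
have cid := computable_id (X * A * bool)%type.
exact: computable_orb (computable_comp cp (computable_fst cid)) (computable_snd cid).
Qed.

Lemma computable_filter (A : countType) (l : X -> seq A) (p : X -> A -> bool) :
  computable l -> computable (fun q : X * A => p q.1 q.2) ->
  computable (fun x => [seq a <- l x | p x a]).
Proof.
move=> cl cp.
apply: (@computable_ext _ _ (fun x =>
    foldr (fun a s => if p x a then a :: s else s) [::] (l x))).
  by move=> x; elim: (l x) => //= a s ->.
apply: computable_foldr => //; first exact: computable_const.
have c2 : computable (fun q : X * A * seq A => q.2) := computable_snd (computable_id _).
have c1 : computable (fun q : X * A * seq A => q.1) := computable_fst (computable_id _).
apply: computable_if => //; first exact: computable_comp cp c1.
by apply: computable_cons => //; apply: computable_snd.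
Qed.

Lemma computable_map (A B : countType) (l : X -> seq A) (h : X -> A -> B) :
  computable l -> computable (fun q : X * A => h q.1 q.2) ->
  computable (fun x => [seq h x a | a <- l x]).
Proof.
move=> cl ch.
apply: (computable_foldr (h := fun x a s => h x a :: s)) => //; first exact: computable_const.
apply: computable_cons; last exact/computable_snd/computable_id.
exact: computable_comp ch (computable_fst (computable_id _)).
Qed.

Lemma computable_cat (A : countType) (f g : X -> seq A) :
  computable f -> computable g -> computable (fun x => f x ++ g x).
Proof.
move=> cf cg.
apply: (@computable_ext _ _ (fun x => foldr cons (g x) (f x))).
  by move=> x; elim: (f x) => //= a s ->.
apply: (computable_foldr (h := fun=> cons)) => //; apply: computable_cons.
  exact/computable_snd/computable_fst/computable_id.
exact/computable_snd/computable_id.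
Qed.

Lemma computable_mem (A : countType) (f : X -> A) (l : X -> seq A) :
  computable f -> computable l -> computable (fun x => f x \in l x).
Proof.
move=> cf cl; apply: (@computable_ext _ _ (fun x => has (fun a => f x == a) (l x))).
  by move=> x; rewrite -has_pred1; apply: eq_has => a; rewrite eq_sym.
apply: computable_has => //; apply: computable_eq.
  exact: computable_comp cf (computable_fst (computable_id _)).
exact/computable_snd/computable_id.
Qed.

End ComputableLists.

Lemma computable_flatten (X A : countType) (f : X -> seq (seq A)) :
  computable f -> computable (fun x => flatten (f x)).
Proof.
move=> cf; apply: (computable_foldr (h := fun=> cat)) => //; first exact: computable_const.
apply: computable_cat; first exact/computable_snd/computable_fst/computable_id.
exact/computable_snd/computable_id.
Qed.

Definition subseqs (A : Type) (l : seq A) : seq (seq A) :=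
  foldr (fun a ws => [seq a :: w | w <- ws] ++ ws) [:: [::]] l.

Lemma computable_subseqs (X A : countType) (l : X -> seq A) :
  computable l -> computable (fun x => subseqs (l x)).
Proof.
have cid := computable_id (X * A * seq (seq A))%type.
move=> cl; apply: (computable_foldr (h := fun _ a ws => [seq a :: w | w <- ws] ++ ws)) => //.
  exact: computable_const.
apply: computable_cat; last exact: computable_snd.
apply: (computable_map (h := fun p w => p.1.2 :: w)); first exact: computable_snd.
apply: computable_cons; last exact/computable_snd/computable_id.
exact/computable_snd/computable_fst/computable_fst/computable_id.
Qed.

(* The rules are selected syntactically, as trying to unify with each of them in
   turn may diverge. *)
Ltac computability := repeat (cbv beta; match goal with
  | |- computable (fun x => x) => exact: computable_id
  | |- computable fst => exact: computable_fst (computable_id _)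
  | |- computable snd => exact: computable_snd (computable_id _)
  | |- computable (fun=> ?c) => exact: computable_const
  | |- computable (fun x => (@?f x).1) => apply: computable_fst
  | |- computable (fun x => (@?f x).2) => apply: computable_snd
  | |- computable (fun x => (@?f x, @?g x)) => apply: computable_pair
  | |- computable (fun x => @?f x :: @?g x) => apply: computable_cons
  | |- computable (fun x => @?f x == @?g x) => apply: computable_eq
  | |- computable (fun x => @?f x && @?g x) => apply: computable_andb
  | |- computable (fun x => @?f x ==> @?g x) => apply: computable_implb
  | |- computable (fun x => ~~ @?f x) => apply: computable_negb
  | |- computable (fun x => size (@?f x)) => apply: computable_size
  | |- computable (fun x => @?f x ++ @?g x) => apply: computable_cat
  | |- computable (fun x => flatten (@?f x)) => apply: computable_flatten
  | |- computable (fun x => subseqs (@?f x)) => apply: computable_subseqs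
  | |- computable (fun x => foldl (@?f x) (@?g x) (@?h x)) =>
      apply: (computable_foldl (h := f))
  | |- computable (foldl ?f ?z) =>
      apply: (computable_foldl (z := fun=> z) (h := fun=> f))
  | |- computable (fun x => map (@?f x) (@?g x)) => apply: (computable_map (h := f))
  | |- computable (fun x => filter (@?f x) (@?g x)) => apply: (computable_filter (p := f))
  | |- computable (fun x => all (@?f x) (@?g x)) => apply: (computable_all (p := f))
  | |- computable (fun x => has (@?f x) (@?g x)) => apply: (computable_has (p := f))
  | |- computable (fun x => nth ?d (@?f x) (@?g x)) =>
      apply: (@computable_nth _ _ d _ _ (erefl 0))
  | |- computable (fun x => @?f x \in @?g x) => apply: computable_mem
  end).

(** * Computing the smallest ER-complex *)

Section Algorithm.
Implicit Types (t : seq (seq nat)) (x y : seq nat) (k : seq (seq nat)).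

Definition table_mul t (i j : nat) : nat := nth 0 (nth [::] t i) j.

(** This is [iota 0 (size t)], written as a fold over the rows to fit the rules of computability. *)
Definition table_elts t : seq nat :=
  foldl (fun s _ => s ++ [:: size s]) [::] t.

(** Selecting from the list of all elements yields an increasing list, so equality of subsets
    becomes equality of lists. *)
Definition subset_mul t x y : seq nat :=
  [seq i <- table_elts t | has (fun a => has (fun b => table_mul t a b == i) y) x].

Definition nonempty_subsets t : seq (seq nat) :=
  [seq x <- subseqs (table_elts t) | x != [::]].

Definition pairs k : seq (seq nat * seq nat) := [seq (x, y) | x <- k, y <- k].

Definition is_equivalence k (r : seq (seq nat * seq nat)) :=
  all (fun x => all (fun y => all (fun z =>
    ((z, z) \in r) && (((x, y) \in r) ==> (((x, z) \in r) == ((y, z) \in r))))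
  k) k) k.

Definition is_stable t k (r : seq (seq nat * seq nat)) :=
  all (fun x => all (fun y => all (fun s => all (fun u => all (fun v =>
    (subset_mul t (subset_mul t x s) u == x) ==>
    (subset_mul t (subset_mul t y s) v == y) ==>
    (((x, y) \in r) == ((subset_mul t x s, subset_mul t y s) \in r)))
  k) k) k) k) k.

(** An exhaustive search through the relations on [k], justified by [typeII_stableP]. *)
Definition list_typeII t k x y :=
  all (fun r => is_equivalence k r && is_stable t k r ==> ((x, y) \in r))
    (subseqs (pairs k)).

Definition class_union t k x : seq nat :=
  [seq i <- table_elts t | has (fun y => list_typeII t k x y && (i \in y)) k].

Definition list_ER_complex t k :=
  [&& all (fun x => all (fun y => subset_mul t x y \in k) k) k,
      all (fun i => [:: i] \in k) (table_elts t),
      all (fun x => all (fun y => all (fun i => i \in x) y ==> (y \in k))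
        (nonempty_subsets t)) k
    & all (fun x => (subset_mul t x x == x) ==> (class_union t k x \in k)) k].

Definition list_C_ER t : seq (seq nat) :=
  [seq x <- nonempty_subsets t |
    all (fun k => list_ER_complex t k ==> (x \in k)) (subseqs (nonempty_subsets t))].

End Algorithm.

Lemma computable_list_C_ER : computable list_C_ER.
Proof.
rewrite /list_C_ER /list_ER_complex /class_union /list_typeII /is_stable.
rewrite /is_equivalence /pairs /allpairs_dep /nonempty_subsets /subset_mul.
rewrite /table_elts /table_mul. computability.
Qed.

Lemma mem_subseqs (A : eqType) (l w : seq A) : (w \in subseqs l) = subseq w l.
Proof.
elim: l w => [|a l IH] [|b w]; rewrite //= mem_cat -/(subseqs l) !IH.
  by rewrite sub0seq orbT.
have [->|nab] := eqVneq b a.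
  rewrite (mem_map (f := cons a)) => [|? ? []//]; rewrite IH orb_idr // => /(subseq_trans _)->//.
  exact: subseq_cons.
by case: mapP => // -[w' _ [eba _]]; rewrite eba eqxx in nab.
Qed.

(** * Correctness of the list algorithm *)

Section Correctness.
Variables (S : finSemigroupType) (s : seq S).
Hypotheses (s_uniq : uniq s) (s_full : forall x, x \in s).
Implicit Types (X Y Z E : powersemi S) (k : seq (seq nat)) (r : seq (seq nat * seq nat)).

Local Notation t := (mult_table s).
Local Notation pos X := (positions s (pset X)).

Lemma index_enum_inj : injective (index^~ s).
Proof. by move=> x y; apply: index_inj. Qed.

Lemma table_mulE x y : table_mul t (index x s) (index y s) = index (x * y)%g s.
Proof.
rewrite /table_mul (nth_map x) ?index_mem // nth_index //.
by rewrite (nth_map y) ?index_mem // nth_index.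
Qed.

Lemma table_eltsE : table_elts t = [seq index x s | x <- s].
Proof.
have -> : table_elts t = iota 0 (size s).
  rewrite -(size_map (fun x => [seq index (x * y)%g s | y <- s])) -/t.
  elim/last_ind: t => // l a IH; rewrite /table_elts foldl_rcons -/(table_elts l) IH.
  by rewrite size_iota size_rcons -addn1 iotaD.
case: s s_uniq => // x0 s0 us; apply: (@eq_from_nth _ 0); rewrite size_iota ?size_map //.
by move=> i lt_i; rewrite nth_iota // (nth_map x0) // index_uniq.
Qed.

Lemma filter_elts (p : pred nat) :
  [seq i <- table_elts t | p i] = positions s [set x | p (index x s)].
Proof.
by rewrite table_eltsE filter_map; congr map; apply: eq_filter => x; rewrite /= inE.
Qed.

Lemma mem_positions (A : {set S}) x : (index x s \in positions s A) = (x \in A).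
Proof.
by rewrite (mem_map (f := index^~ s)) ?mem_filter ?s_full ?andbT //; apply: index_enum_inj.
Qed.

Lemma has_positions (A : {set S}) (p : pred nat) :
  has p (positions s A) = [exists x in A, p (index x s)].
Proof.
rewrite has_map; apply/hasP/exists_inP => -[x]; rewrite ?mem_filter.
  by move=> /andP[Ax _] px; exists x.
by move=> Ax px; exists x; rewrite // mem_filter Ax s_full.
Qed.

Lemma positions_inj : injective (positions s).
Proof. by move=> A B eqAB; apply/setP => x; rewrite -!mem_positions eqAB. Qed.

Lemma pos_inj X Y : pos X = pos Y -> X = Y.
Proof. by move=> /positions_inj/val_inj. Qed.

Lemma positions_eq0 (A : {set S}) : (positions s A == [::]) = (A == set0).
Proof.
rewrite -(inj_eq positions_inj) (_ : positions s set0 = [::]) // /positions.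
by rewrite (eq_filter (a2 := pred0)) ?filter_pred0 // => x; rewrite /= inE.
Qed.

Lemma subset_mulE X Y : subset_mul t (pos X) (pos Y) = pos (X * Y)%g.
Proof.
rewrite /subset_mul filter_elts; congr positions; apply/setP => z; rewrite inE has_positions.
apply/exists_inP/powersemiME => [[x Xx]|[x [y [Xx Yy ->]]]].
  rewrite has_positions => /exists_inP[y Yy].
  by rewrite table_mulE => /eqP/index_enum_inj <-; exists x, y.
exists x => //; rewrite has_positions; apply/exists_inP; exists y => //.
by rewrite table_mulE.
Qed.

Lemma mem_nonempty_subsets w :
  reflect (exists X, w = pos X) (w \in nonempty_subsets t).
Proof.
rewrite mem_filter mem_subseqs; apply: (iffP andP) => [[w0 sub_w]|[X ->]].
  have ut : uniq (table_elts t) by rewrite table_eltsE (map_inj_uniq index_enum_inj).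
  move: sub_w => /(subseq_uniqP ut); rewrite filter_elts; set A := [set _ | _] => wA.
  have A0 : A != set0 by rewrite -positions_eq0 -wA.
  by exists (PowerSemi A0).
rewrite positions_eq0 pset_neq0; split=> //.
by rewrite table_eltsE map_subseq // filter_subseq.
Qed.

Definition family k : {set powersemi S} := [set X | pos X \in k].

Lemma mem_family k X : (X \in family k) = (pos X \in k). Proof. exact: in_set. Qed.

Section Family.
Variable k : seq (seq nat).
Hypothesis k_sub : {subset k <= nonempty_subsets t}.
Let K := family k.

Lemma all_family (p : pred (seq nat)) : all p k <-> forall X, X \in K -> p (pos X).
Proof.
split=> [/allP kp X|Kp]; first by rewrite mem_family => /kp.
apply/allP => w kw; have /mem_nonempty_subsets[X wX] := k_sub kw.
by rewrite wX; apply: Kp; rewrite mem_family -wX.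
Qed.

Lemma has_family (p : pred (seq nat)) : has p k <-> exists2 X, X \in K & p (pos X).
Proof.
split=> [/hasP[w kw pw]|[X]]; last by rewrite mem_family => kX pX; apply/hasP; exists (pos X).
have /mem_nonempty_subsets[X wX] := k_sub kw.
by exists X; rewrite ?mem_family -wX.
Qed.

Definition rel_of r : rel (powersemi S) := fun X Y => (pos X, pos Y) \in r.

Lemma is_equivalenceP r :
  is_equivalence k r <-> {in K & &, equivalence_rel (rel_of r)}.
Proof.
rewrite all_family; split=> [eq_r X Y Z KX KY KZ|eq_r X KX].
  have /all_family/(_ Y KY)/all_family/(_ Z KZ)/andP[rZ /implyP rXY] := eq_r X KX.
  by split=> // /rXY/eqP.
apply/all_family => Y KY; apply/all_family => Z KZ.
have [rZ rXY] := eq_r X Y Z KX KY KZ; rewrite -/(rel_of r Z Z) rZ /=.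
by apply/implyP => /rXY/eqP.
Qed.

Lemma is_stableP r : is_stable t k r <-> stable K (rel_of r).
Proof.
rewrite all_family; split=> [st_r X Y s' U V KX KY Ks KU KV XsU YsV|st_r X KX].
  have /all_family/(_ Y KY)/all_family/(_ s' Ks) := st_r X KX.
  move=> /all_family/(_ U KU)/all_family/(_ V KV).
  by rewrite !subset_mulE XsU YsV !eqxx => /eqP.
do 4![apply/all_family => ? ?]; rewrite !subset_mulE.
apply/implyP => /eqP/pos_inj XsU; apply/implyP => /eqP/pos_inj YsV.
by apply/eqP; apply: st_r XsU YsV.
Qed.

Lemma list_typeIIP X Y : subsemigroup K -> X \in K -> Y \in K ->
  list_typeII t k (pos X) (pos Y) = typeII K X Y.
Proof.
move=> cK KX KY; have mK := subsemigroupP _ cK.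
apply/allP/idP => [all_r|/(typeII_stableP cK KX KY) all_r r _]; last first.
  by apply/implyP => /andP[/is_equivalenceP eq_r /is_stableP st_r]; exact: (all_r (rel_of r)).
apply/(typeII_stableP cK KX KY) => rr eq_rr st_rr.
(* [r] lists the restriction of [rr] to [K]. Being stable is a condition on members of [K] only,
   since [K] is closed under products. *)
pose r := [seq p <- pairs k |
  [exists A, exists B, (p == (pos A, pos B)) && rr A B]].
have rE A B : A \in K -> B \in K -> rel_of r A B = rr A B.
  rewrite !mem_family => kA kB; rewrite /rel_of mem_filter allpairs_f // andbT.
  apply/existsP/idP => [[A' /existsP[B' /andP[/eqP[/pos_inj-> /pos_inj->]]]]//|rAB].
  by exists A; apply/existsP; exists B; rewrite eqxx.
have r_in : r \in subseqs (pairs k) by rewrite mem_subseqs filter_subseq.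
rewrite -rE //; apply: (implyP (all_r r r_in)); apply/andP; split.
  by apply/is_equivalenceP => A B C KA KB KC; rewrite !rE //; apply: eq_rr.
apply/is_stableP => A B C U V KA KB KC KU KV AC BC.
by rewrite !rE ?mK //; apply: st_rr AC BC.
Qed.

Lemma class_unionE E : subsemigroup K -> E \in K ->
  class_union t k (pos E) = positions s (\bigcup_(X in typeII_class K E) pset X).
Proof.
move=> cK KE; rewrite /class_union filter_elts; congr positions; apply/setP => x.
rewrite inE; apply/idP/bigcupP => [/has_family[X KX]|[X]].
  by rewrite list_typeIIP // mem_positions => /andP[EX Xx]; exists X; rewrite // inE KX.
rewrite inE => /andP[KX EX] Xx; apply/has_family; exists X => //.
by rewrite list_typeIIP // EX mem_positions.
Qed.

Lemma positions_subset (A B : {set S}) :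
  all (fun i => i \in positions s A) (positions s B) = (B \subset A).
Proof.
apply/allP/subsetP => [sBA x Bx|sBA i].
  by rewrite -mem_positions sBA ?mem_positions.
case/mapP => x; rewrite mem_filter => /andP[Bx _] ->.
by rewrite mem_positions sBA.
Qed.

Lemma positions1 x : positions s [set x] = [:: index x s].
Proof.
rewrite /positions (eq_filter (a2 := pred1 x)) => [|y]; last by rewrite /= inE.
by rewrite filter_pred1_uniq.
Qed.

Lemma list_ER_complexP : list_ER_complex t k <-> ER_complex K.
Proof.
have mulE : all (fun x => all (fun y => subset_mul t x y \in k) k) k <-> subsemigroup K.
  rewrite all_family; split=> [mk|/subsemigroupP mK X KX].
    apply/subsemigroupP => X Y KX KY; have /all_family/(_ Y KY) := mk X KX.
    by rewrite subset_mulE mem_family.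
  by apply/all_family => Y KY; rewrite subset_mulE -mem_family mK.
have oneE : all (fun i => [:: i] \in k) (table_elts t) <-> forall x, powersemi1 x \in K.
  rewrite table_eltsE all_map; split=> [/allP k1 x|K1].
    by rewrite mem_family /= positions1; apply: k1.
  by apply/allP => x _; rewrite /= -positions1 -[[set x]]/(pset (powersemi1 x)) -mem_family.
have subE : all (fun x => all (fun y => all (fun i => i \in x) y ==> (y \in k))
    (nonempty_subsets t)) k <->
    forall X Y, X \in K -> pset Y \subset pset X -> Y \in K.
  rewrite all_family; split=> [kS X Y KX YX|KS X KX].
    have /allP/(_ (pos Y)) := kS X KX; rewrite positions_subset YX mem_family; apply.
    by apply/mem_nonempty_subsets; exists Y.
  apply/allP => _ /mem_nonempty_subsets[Y ->]; rewrite positions_subset.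
  by apply/implyP => /(KS X Y KX); rewrite mem_family.
(* Type-II classes are computed correctly in a subsemigroup; the first of the four tests provides
   this. *)
have classE : subsemigroup K ->
    all (fun x => (subset_mul t x x == x) ==> (class_union t k x \in k)) k <->
    forall E, E \in K -> idem E -> exists2 U, U \in K &
      pset U = \bigcup_(X in typeII_class K E) pset X.
  move=> cK; rewrite all_family; split=> [kE E KE /eqP EE|KE E E_K].
    have := kE E KE; rewrite subset_mulE EE eqxx /= class_unionE // => kU.
    have /mem_nonempty_subsets[U /positions_inj UE] := k_sub kU.
    by exists U; rewrite // mem_family -UE.
  apply/implyP; rewrite subset_mulE class_unionE // => /eqP/pos_inj EE.
  have [||U KU <-] := KE E; rewrite ?/idem ?EE //.
  by rewrite -mem_family.
split=> [/and4P[/mulE cK /oneE K1 /subE KS /(classE cK) KE]|].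
  by apply/ER_complexP; split=> //; apply/complexP.
case/ER_complexP => /complexP[cK K1 KS] KE; apply/and4P; split.
- exact/mulE.
- exact/oneE.
- exact/subE.
exact/(classE cK).
Qed.

End Family.

Lemma mem_list_C_ER X : (pos X \in list_C_ER t) = (X \in C_ER S).
Proof.
rewrite mem_filter andbC (introT (mem_nonempty_subsets _) (ex_intro _ X erefl)) /=.
apply/allP/bigcapP => [all_k K K_ER|CX k].
  (* Listing [K] in the order of [nonempty_subsets t] makes it one of the subsequences that are
     searched. *)
  pose k := [seq w <- nonempty_subsets t | w \in [seq pos X | X in K]].
  have kE : family k = K.
    apply/setP => Y; rewrite mem_family mem_filter andbC.
    rewrite (introT (mem_nonempty_subsets _) (ex_intro _ Y erefl)) /=.
    apply/imageP/idP => [[Y' KY' /pos_inj->] //|KY]; by exists Y.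
  have k_sub : {subset k <= nonempty_subsets t} by move=> w; rewrite mem_filter => /andP[].
  have k_in : k \in subseqs (nonempty_subsets t) by rewrite mem_subseqs filter_subseq.
  rewrite -kE mem_family; apply: (implyP (all_k k k_in)).
  by apply/(list_ER_complexP k_sub); rewrite kE.
rewrite mem_subseqs => /mem_subseq k_sub; apply/implyP => /(list_ER_complexP k_sub) k_ER.
by rewrite -mem_family; apply: CX.
Qed.

Lemma list_C_ERE : list_C_ER t =i [seq pos X | X in C_ER S].
Proof.
move=> w; apply/idP/imageP => [Cw|[X CX ->]]; last by rewrite mem_list_C_ER.
have /mem_nonempty_subsets[X wX] : w \in nonempty_subsets t.
  by move: Cw; rewrite mem_filter => /andP[].
by exists X; rewrite -?mem_list_C_ER -?wX.
Qed.

End Correctness.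

Lemma encodeE (l : seq (seq nat)) : encode l = pickle l.
Proof.
by congr CodeSeq.code; apply: eq_map => w; rewrite [pickle w]/(CodeSeq.code _) map_id.
Qed.

Theorem theorem8p7 :
  decidable_pointlikes ER /\ (forall S : finSemigroupType, PL S ER = C_ER S).
Proof.
split; last exact: PL_ER_eq.
have [f fP] := computable_list_C_ER; exists f => S s s_uniq s_full.
exists (list_C_ER (mult_table s)); first by rewrite !encodeE; apply: fP.
by rewrite PL_ER_eq; apply: list_C_ERE.
Qed.
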